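(* Let $d\ge 1$ and let $\mathcal{T}:\mathcal{M}_d\to\mathcal{M}_d$ be a quantum channel. Let $\mathbb{C}^d = H_0\oplus\bigoplus_{k=1}^K (H_{k,1}\otimes H_{k,2})$ be a decomposition such that the peripheral subspace of $\mathcal{T}$ satisfies $\chi_{\mathcal{T}} = 0\oplus\bigoplus_{k=1}^K \mathcal{M}_{d_k}\otimes\omega_k$, where $\mathcal{M}_{d_k}$ is the full matrix algebra on $H_{k,1}$, $d_k=\dim H_{k,1}$, and $\omega_k$ is a density operator on $H_{k,2}$. Then for every $\delta\in[0,1)$, $$C^\infty_\delta(\mathcal{T}) = \log\left(\left\lfloor \frac{\sum_{k=1}^K d_k}{1-\delta}\right\rfloor\right),$$ and $$\log\left(\left\lfloor \frac{\max_k d_k}{\sqrt{1-\delta}}\right\rfloor\right)\le Q^\infty_\delta(\mathcal{T})\le \log\left(\frac{\max_k d_k}{1-\delta}\right).$$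
   Context: A quantum channel is a completely positive trace-preserving linear map. For a channel $\mathcal{T}:\mathcal{M}_d\to\mathcal{M}_d$, a channel $\mathcal{E}:\mathcal{M}_D\to\mathcal{M}_d$ is a $(D,\delta)$ classical code for $\mathcal{T}$ if there is a channel $\mathcal{R}:\mathcal{M}_d\to\mathcal{M}_D$ with $\frac1D\sum_{i=1}^D\langle i|\mathcal{R}\circ\mathcal{T}\circ\mathcal{E}(|i\rangle\langle i|)|i\rangle\ge 1-\delta$ for a fixed orthonormal basis $\{|i\rangle\}$ of $\mathbb{C}^D$; it is a $(D,\delta)$ quantum code if there is a channel $\mathcal{R}$ with $\langle\Phi^+|(\mathcal{I}\otimes(\mathcal{R}\circ\mathcal{T}\circ\mathcal{E}))(|\Phi^+\rangle\langle\Phi^+|)|\Phi^+\rangle\ge1-\delta$, where $|\Phi^+\rangle=\frac{1}{\sqrt D}\sum_{i=1}^D|i\rangle\otimes|i\rangle$ and $\mathcal{I}$ is the identity channel on $\mathcal{M}_D$. The one-shot capacities are $C_\delta(\mathcal{T})=\sup\log D$ over $(D,\delta)$ classical codes and $Q_\delta(\mathcal{T})=\sup\log D$ over $(D,\delta)$ quantum codes. The infinite-time capacities are $C^\infty_\delta(\mathcal{T})=\lim_{t\to\infty}C_\delta(\mathcal{T}^t)$ and $Q^\infty_\delta(\mathcal{T})=\lim_{t\to\infty}Q_\delta(\mathcal{T}^t)$, where $\mathcal{T}^t$ is the $t$-fold composition. The peripheral subspace is $\chi_{\mathcal{T}}=\mathrm{span}\{X\in\mathcal{M}_d:\mathcal{T}(X)=\lambda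 X,\ \lambda\in\mathbb{C},\ |\lambda|=1\}$; it is known that for every channel a decomposition of $\chi_{\mathcal{T}}$ of the stated form exists. *)

(* Defs.v *)
(* MathComp + MathComp-Analysis; scalars are R[i] (complex numbers
   over an arbitrary R : realType, from mathcomp-real-closed). *)
From HB Require Import structures.
From mathcomp Require Import all_boot all_order all_algebra.
From mathcomp Require Import all_classical all_reals all_analysis.
From mathcomp Require Import complex mxtens.
From mathcomp Require Import sesquilinear.

Set Implicit Arguments.
Unset Strict Implicit.
Unset Printing Implicit Defensive.

Import Order.TTheory GRing.Theory Num.Theory.
Local Open Scope classical_set_scope.
Local Open Scope ring_scope.
Local Open Scope sesquilinear_scope.

Section Quantum.
Variable R : realType.
Local Notation C := (R[i]).

(* maps M_n -> M_m *)
Definition linmap (n m : nat) := 'M[C]_n -> 'M[C]_m.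

(* positive semidefinite matrices *)
Definition psdmx n (A : 'M[C]_n) : Prop :=
  A ^t* = A /\ forall v : 'cV[C]_n, 0 <= (v ^t* *m A *m v) 0 0.

(* density operators *)
Definition density n (A : 'M[C]_n) : Prop := psdmx A /\ \tr A = 1.

(* (I_k (x) T) acting on M_k (x) M_n = M_(k*n); indices via mxtens_index *)
Definition ampl k n m (T : linmap n m) (X : 'M[C]_(k * n)) : 'M[C]_(k * m) :=
  \sum_(i < k) \sum_(j < k)
     delta_mx i j *t T (\matrix_(a, b) X (mxtens_index (i, a)) (mxtens_index (j, b))).

(* quantum channel: completely positive trace-preserving linear map *)
Definition is_channel n m (T : linmap n m) : Prop :=
  [/\ (forall (a : C) (X Y : 'M[C]_n), T (a *: X + Y) = a *: T X + T Y),
      (forall k (X : 'M[C]_(k * n)), psdmx X -> psdmx (ampl T X)) &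
      (forall X : 'M[C]_n, \tr (T X) = \tr X)].

(* (D, delta) classical code for N *)
Definition classical_code d D (N : linmap d d) (E : linmap D d) (delta : R) : Prop :=
  is_channel E /\ exists Rd : linmap d D, is_channel Rd /\
    ((1 - delta)%:C <= D%:R^-1 * \sum_(i < D) (Rd (N (E (delta_mx i i)))) i i)%C.

(* maximally entangled vector Phi+ in C^D (x) C^D *)
Definition maxent D : 'cV[C]_(D * D) :=
  \col_p (if (mxtens_unindex p).1 == (mxtens_unindex p).2 :> nat
          then ((Num.sqrt (D%:R : R))%:C)^-1 else 0)%C.

(* (D, delta) quantum code for N *)
Definition quantum_code d D (N : linmap d d) (E : linmap D d) (delta : R) : Prop :=
  is_channel E /\ exists Rd : linmap d D, is_channel Rd /\
    ((1 - delta)%:C <=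
      ((maxent D) ^t* *m ampl (fun X => Rd (N (E X))) (maxent D *m (maxent D) ^t*)
        *m maxent D) 0 0)%C.

Definition log2 (x : R) : R := ln x / ln 2.

(* one-shot capacities *)
Definition Ccap d (N : linmap d d) (delta : R) : \bar R :=
  ereal_sup [set (log2 D%:R)%:E | D in
    [set D : nat | (0 < D)%N /\ exists E : linmap D d, classical_code N E delta]].

Definition Qcap d (N : linmap d d) (delta : R) : \bar R :=
  ereal_sup [set (log2 D%:R)%:E | D in
    [set D : nat | (0 < D)%N /\ exists E : linmap D d, quantum_code N E delta]].

(* t-fold composition *)
Definition chpow d (T : linmap d d) (t : nat) : linmap d d := iter t T.

(* peripheral subspace: span of eigenvectors with unimodular eigenvalues *)
Definition peripheral d (T : linmap d d) : set 'M[C]_d :=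
  [set X | exists (n : nat) (c lam : 'I_n -> C) (Y : 'I_n -> 'M[C]_d),
     (forall i, `|lam i| = 1 /\ T (Y i) = lam i *: Y i) /\
     X = \sum_(i < n) c i *: Y i].

End Quantum.

(* Main.v *)
Require Import Defs.
From HB Require Import structures.
From mathcomp Require Import all_boot all_order all_algebra.
From mathcomp Require Import all_classical all_reals all_analysis.
From mathcomp Require Import complex mxtens sesquilinear spectral ring lra.
Import Order.TTheory GRing.Theory Num.Theory numFieldNormedType.Exports.
Local Open Scope classical_set_scope.
Local Open Scope ring_scope.
Local Open Scope sesquilinear_scope.

(** Let P be the limit of T^(n-m) as first n and then m tends to infinity along an
    ultrafilter. It is a channel onto the peripheral space, T^t (X - P X) tends to 0, and
    the same construction yields channels A_t with A_t T^t = id on the peripheral space.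
    On the blocks M_{d_k}, P = sum_k G_k F_k with channels G_k and completely positive F_k
    such that tr X = sum_k tr (F_k X).

    Upper bounds: for positive matrices |sum_pq J_pq J'_pq| <= tr J tr J'; applied to the
    Choi matrices of the decoder after G_k and of F_k after the encoder, this bounds the
    sum of the success probabilities by sum_k d_k in the classical case, and D^2 times the
    fidelity by D max_k d_k in the quantum case, up to D (resp. D^2) times an error that
    depends on t only. So the limiting bounds on D already hold at some finite t.

    Lower bounds: A_t undoes T^t on states supported in the blocks. Transmit perfectly as
    many of the D levels as the blocks can hold and give up on the others. *)

Set Implicit Arguments.
Unset Strict Implicit.
Unset Printing Implicit Defensive.

(** Why two limits: a power of [T] multiplies a peripheral eigenvector by lam^n, and the ultrafilter
    limit of these numbers is an unknown phase mu. A second limit of the conjugate powers cancels mu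
    whatever it is, so the eigenvalues need not be approximated simultaneously. Along an ultrafilter
    every bounded sequence converges, hence all entries of all images converge together, and the
    limit of channels is a channel.

    The decay of T^t (X - P X) is obtained without a Jordan form. The factors T - r of the
    characteristic polynomial annihilate X by Cayley-Hamilton. They are applied with the roots |r| <
    1 first and then undone backwards: the outer roots leave a peripheral matrix, and each inner
    root adds a remainder that contracts.

    In the upper bounds the code may change with t and D is not bounded in advance. The error is
    therefore measured on the matrix units of M_d, uniformly in encoder, decoder and D, and the
    integrality of D turns the approximate inequality into the exact one. *)

(** * Positive kernels and a trace inequality *)

Section PositiveKernels.
Variable C : numClosedFieldType.

(** Symmetry comes from the vectors (1, 1) and (1, i). The minor bound comes from (e, - conj b) if e
    > 0, from (-b, a) if e = 0 < a, and from (-b, 1) if both vanish. *)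
Lemma positive_form2 (a b c e : C) :
  (forall x y, 0 <= x^* * (a * x + b * y) + y^* * (c * x + e * y)) ->
  [/\ 0 <= a, 0 <= e, c = b^* & `|b| ^+ 2 <= a * e].
Proof.
move=> H.
have a0 : 0 <= a by have := H 1 0; rewrite conjC1 conjC0 !(mul1r, mulr1, mul0r, mulr0, addr0, add0r).
have e0 : 0 <= e by have := H 0 1; rewrite conjC1 conjC0 !(mul1r, mulr1, mul0r, mulr0, addr0, add0r).
have conj_real (z : C) : 0 <= z -> z^* = z by move=> /ger0_real /CrealP.
have ar := conj_real _ a0; have er := conj_real _ e0.
have cb : c = b^*.
  have H1 := conj_real _ (H 1 1).
  have H2 := conj_real _ (H 1 'i).
  move: H1 H2.
  rewrite !(rmorphD, rmorphM, rmorphN) /= ?(conjCK, conjC1, conjCi, rmorphN) /= !(conjC1, conjCi, ar, er) => H1 H2.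
  have i2 : 'i * 'i = -1 :> C by rewrite -expr2 sqrCi.
  have E1 : b^* + c^* = b + c.
    apply: (addrI (a + e)).
    by transitivity (1 * (a * 1 + b^* * 1) + 1 * (c^* * 1 + e * 1)); [ring|rewrite H1; ring].
  have E2 : 'i * (c^* - b^*) = 'i * (b - c).
    apply: (addrI (a - 'i * 'i * e)).
    transitivity (1 * (a * 1 + b^* * - 'i) + - - 'i * (c^* * 1 + e * - 'i)); first by ring.
    by rewrite H2; ring.
  have E3 : c^* - b^* = b - c by apply: (mulfI (neq0Ci C)).
  have E4 : c^* *+ 2 = b *+ 2.
    rewrite !mulr2n; transitivity ((b^* + c^*) + (c^* - b^*)); first by ring.
    by rewrite E1 E3; ring.
  have E5 : c^* = b.
    by apply: (mulfI (_ : 2%:R != 0)); rewrite ?pnatr_eq0 // !mulr_natl.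
  by rewrite -E5 conjCK.
split=> //.
have nb : b^* * b = `|b| ^+ 2 by rewrite normCK mulrC.
have [e_gt|e_le] := boolP (0 < e).
  have := H e (- b^*); rewrite rmorphN /= conjCK er cb.
  have -> : e * (a * e + b * - b^*) + - b * (b^* * e + e * - b^*) = e * (a * e - b^* * b) by ring.
  by rewrite nb pmulr_rge0 // subr_ge0.
have e00 : e = 0 by apply/eqP; move: e_le; rewrite lt0r e0 andbT negbK.
have [a_gt|a_le] := boolP (0 < a).
  have := H (- b) a; rewrite rmorphN /= ar cb e00.
  have -> : - b^* * (a * - b + b * a) + a * (b^* * - b + 0 * a) = a * (- (b^* * b)) by ring.
  by rewrite nb pmulr_rge0 // mulr0 oppr_ge0.
have a00 : a = 0 by apply/eqP; move: a_le; rewrite lt0r a0 andbT negbK.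
have := H (- b) 1; rewrite rmorphN /= conjC1 cb a00 e00.
have -> : - b^* * (0 * - b + b * 1) + 1 * (b^* * - b + 0 * 1) = - ((b^* * b) *+ 2) by ring.
by rewrite nb oppr_ge0 mul0r pmulrn_lle0.
Qed.

(** With kernels on any finite type, pairs can index tensor products, and regrouping or swapping
    factors is composition with a map of indices. *)
Definition posker (I : finType) (f : I -> I -> C) : Prop :=
  forall v : I -> C, 0 <= \sum_p \sum_q (v p)^* * f p q * v q.

Section Theory.
Variables (I : finType) (f : I -> I -> C).
Hypothesis pf : posker f.

Lemma posker2 p q x y :
  0 <= x^* * (f p p * x + f p q * y) + y^* * (f q p * x + f q q * y).
Proof.
have S2 (g : I -> C) (s t : C) :
    \sum_r g r * (s * (r == p)%:R + t * (r == q)%:R) = g p * s + g q * t.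
  have D u (z : C) : \sum_r g r * (z * (r == u)%:R) = g u * z.
    rewrite (bigD1 u) //= eqxx mulr1 big1 ?addr0 // => i /negbTE ->.
    by rewrite !mulr0.
  by rewrite -!D -big_split /=; apply: eq_bigr => r _; rewrite mulrDr.
have := pf (fun r => x * (r == p)%:R + y * (r == q)%:R).
under eq_bigr => r _.
  under eq_bigr => s _ do rewrite -mulrA.
  rewrite -mulr_sumr S2 rmorphD !rmorphM /= !conjC_nat mulrC.
  over.
by rewrite S2 ![_ * x^*]mulrC ![_ * y^*]mulrC.
Qed.

Lemma posker_ge0 p : 0 <= f p p.
Proof. by have [] := positive_form2 (posker2 p p). Qed.

Lemma posker_conj p q : f q p = (f p q)^*.
Proof. by have [] := positive_form2 (posker2 p q). Qed.

Lemma posker_minor p q : `|f p q| ^+ 2 <= f p p * f q q.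
Proof. by have [] := positive_form2 (posker2 p q). Qed.

End Theory.

(** The 2 by 2 minors of [f] and [g] and the inequality of arithmetic and geometric means give 2
    |f_pq g_pq| <= f_pp g_qq + f_qq g_pp. Summed over p and q, the right side is twice the product
    of the traces. *)
Lemma posker_sum_mul_le (I : finType) (f g : I -> I -> C) :
  posker f -> posker g ->
  `|\sum_p \sum_q f p q * g p q| <= (\sum_p f p p) * (\sum_q g q q).
Proof.
move=> pf pg.
have f0 := posker_ge0 pf; have g0 := posker_ge0 pg.
have key p q : `|f p q * g p q| *+ 2 <= f p p * g q q + f q q * g p p.
  have h0 : 0 <= f p p * g q q + f q q * g p p by rewrite addr_ge0 ?mulr_ge0.
  rewrite -(ler_pXn2r (isT : (0 < 2)%N)) ?nnegrE ?mulrn_wge0 //.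
  apply: le_trans (_ : (f p p * g q q) * (f q q * g p p) *+ 4 <= _).
    rewrite exprMn_n lerMn2r /= normrM exprMn.
    have -> : f p p * g q q * (f q q * g p p) = (f p p * f q q) * (g p p * g q q) by ring.
    by apply: ler_pM; rewrite ?exprn_ge0 ?posker_minor.
  rewrite -subr_ge0.
  have -> : (f p p * g q q + f q q * g p p) ^+ 2 - f p p * g q q * (f q q * g p p) *+ 4
     = (f p p * g q q - f q q * g p p) ^+ 2 by ring.
  rewrite real_exprn_even_ge0 //.
  by rewrite rpredB // ger0_real // mulr_ge0.
have le2 (x y : C) : x *+ 2 <= y *+ 2 -> x <= y by rewrite lerMn2r.
apply: le2.
apply: le_trans (_ : \sum_p \sum_q `|f p q * g p q| *+ 2 <= _).
  under [leRHS]eq_bigr => p _ do rewrite sumrMnl.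
  rewrite sumrMnl lerMn2r /=.
  apply: le_trans (ler_norm_sum _ _ _) _; apply: ler_sum => p _.
  exact: ler_norm_sum.
apply: le_trans (_ : \sum_p \sum_q (f p p * g q q + f q q * g p p) <= _).
  by apply: ler_sum => p _; apply: ler_sum => q _.
have E : \sum_p \sum_q f p p * g q q = (\sum_p f p p) * (\sum_q g q q).
  by rewrite mulr_suml; apply: eq_bigr => p _; rewrite mulr_sumr.
under eq_bigr => p _ do rewrite big_split.
rewrite big_split /= [X in _ + X]exchange_big /= E mulr2n //.
Qed.

Lemma psd_posker n (A : 'M[C]_n) :
  (forall v : 'cV[C]_n, 0 <= (v ^t* *m A *m v) 0 0) <-> posker (fun i j => A i j).
Proof.
have E (v : 'cV[C]_n) :
    (v ^t* *m A *m v) 0 0 = \sum_p \sum_q (v p 0)^* * A p q * v q 0.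
  rewrite mxE exchange_big /=; apply: eq_bigr => q _.
  rewrite mxE mulr_suml; apply: eq_bigr => p _; by rewrite !mxE.
split=> H v; last by rewrite E; apply: H.
have := H (\col_i v i); rewrite E.
by under eq_bigr => p _ do under eq_bigr => q _ do rewrite !mxE.
Qed.

End PositiveKernels.

(** * Complete positivity and the bounds for a single block *)

Section CompletelyPositive.
Variable C : numClosedFieldType.

(** A test vector is pushed forward along [h] by summing over its fibres. As [h] is arbitrary, this
    covers restricting, swapping and duplicating indices. *)
Lemma posker_comp (I J : finType) (h : J -> I) (f : I -> I -> C) :
  posker f -> posker (fun p q => f (h p) (h q)).
Proof.
move=> pf v.
have := pf (fun r => \sum_(p | h p == r) v p).
suff -> : \sum_r \sum_s (\sum_(p | h p == r) v p)^* * f r s * (\sum_(p | h p == s) v p) =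
  \sum_p \sum_q (v p)^* * f (h p) (h q) * v q by [].
rewrite [RHS](partition_big h xpredT) //=; apply: eq_bigr => r _.
under eq_bigr => s _ do rewrite rmorph_sum mulr_suml mulr_suml.
rewrite exchange_big /=; apply: eq_bigr => p /eqP hp.
rewrite [RHS](partition_big h xpredT) //=; apply: eq_bigr => s _.
rewrite mulr_sumr; apply: eq_bigr => q /eqP hq.
by rewrite hp hq.
Qed.

Definition mxlinear n m (T : 'M[C]_n -> 'M[C]_m) :=
  forall (a : C) X Y, T (a *: X + Y) = a *: T X + T Y.

Section Linear.
Variables (n m : nat) (T : 'M[C]_n -> 'M[C]_m).
Hypothesis lT : mxlinear T.
Let L : {linear 'M[C]_n -> 'M[C]_m} := HB.pack T (GRing.isLinear.Build _ _ _ _ T lT).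

Lemma mxlin_sum (I : Type) (r : seq I) (P : pred I) F :
  T (\sum_(i <- r | P i) F i) = \sum_(i <- r | P i) T (F i).
Proof. exact: (linear_sum L). Qed.
Lemma mxlinZ a X : T (a *: X) = a *: T X.
Proof. exact: (linearZ_LR L). Qed.
Lemma mxlinD X Y : T (X + Y) = T X + T Y.
Proof. exact: (linearD L). Qed.
Lemma mxlinB X Y : T (X - Y) = T X - T Y.
Proof. exact: (linearB L). Qed.
Lemma mxlin0 : T 0 = 0.
Proof. exact: (linear0 L). Qed.

Lemma mxlinE X : T X = \sum_a \sum_b X a b *: T (delta_mx a b).
Proof.
rewrite {1}(matrix_sum_delta X) mxlin_sum; apply: eq_bigr => a _.
by rewrite mxlin_sum; apply: eq_bigr => b _; rewrite mxlinZ.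
Qed.
End Linear.

Lemma mxlin_comp n m p (S : 'M[C]_m -> 'M[C]_p) (T : 'M[C]_n -> 'M[C]_m) :
  mxlinear S -> mxlinear T -> mxlinear (S \o T).
Proof. by move=> lS lT a X Y /=; rewrite lT lS. Qed.

(** Positivity on the tensor product of C^k and C^n in block form, without flattening pairs of
    indices; [is_channelP] translates to the flattened form. *)
Definition posblk k n (X : 'I_k -> 'I_k -> 'M[C]_n) := forall w : 'I_k -> 'cV[C]_n,
  0 <= \sum_i \sum_j ((w i) ^t* *m X i j *m w j) 0 0.

Lemma posblkP k n (X : 'I_k -> 'I_k -> 'M[C]_n) :
  posblk X <-> posker (fun p q : 'I_k * 'I_n => X p.1 q.1 p.2 q.2).
Proof.
have E (w : 'I_k -> 'cV[C]_n) :
   \sum_i \sum_j ((w i) ^t* *m X i j *m w j) 0 0 =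
   \sum_(p : 'I_k * 'I_n) \sum_(q : 'I_k * 'I_n)
     (w p.1 p.2 0)^* * X p.1 q.1 p.2 q.2 * w q.1 q.2 0.
  rewrite -(pair_bigA _ (fun i a => \sum_(q : 'I_k * 'I_n)
     (w i a 0)^* * X i q.1 a q.2 * w q.1 q.2 0)) /=.
  apply: eq_bigr => i _; rewrite exchange_big /=.
  rewrite -(pair_bigA _ (fun j b => \sum_a (w i a 0)^* * X i j a b * w j b 0)) /=.
  apply: eq_bigr => j _; rewrite mxE; apply: eq_bigr => b _.
  by rewrite mxE mulr_suml; apply: eq_bigr => a _; rewrite !mxE.
split=> H v; last by rewrite E; apply: (H (fun p => v p.1 p.2 0)).
have := H (fun i => \col_a v (i, a)); rewrite E.
rewrite (eq_bigr (fun p => \sum_q (v p)^* * X p.1 q.1 p.2 q.2 * v q)) //.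
by case=> i a _; apply: eq_bigr => -[j b] _; rewrite !mxE.
Qed.

Definition cpmap n m (T : 'M[C]_n -> 'M[C]_m) :=
  mxlinear T /\ forall k (X : 'I_k -> 'I_k -> 'M[C]_n),
    posblk X -> posblk (fun i j => T (X i j)).

Definition cptp n m (T : 'M[C]_n -> 'M[C]_m) :=
  cpmap T /\ forall X, \tr (T X) = \tr X.

Lemma cp_comp n m p (S : 'M[C]_m -> 'M[C]_p) (T : 'M[C]_n -> 'M[C]_m) :
  cpmap S -> cpmap T -> cpmap (S \o T).
Proof.
move=> [lS pS] [lT pT]; split; first exact: mxlin_comp.
by move=> k X /pT /pS.
Qed.

Lemma cptp_comp n m p (S : 'M[C]_m -> 'M[C]_p) (T : 'M[C]_n -> 'M[C]_m) :
  cptp S -> cptp T -> cptp (S \o T).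
Proof.
by move=> [cS tS] [cT tT]; split=> [|X /=]; [apply: cp_comp|rewrite tS tT].
Qed.

Lemma cptp_id n : cptp (fun X : 'M[C]_n => X).
Proof. by []. Qed.

Lemma cptp_iter n (T : 'M[C]_n -> 'M[C]_n) t : cptp T -> cptp (iter t T).
Proof.
move=> cT; elim: t => [|t IH]; first exact: cptp_id.
exact: (cptp_comp cT IH).
Qed.

Lemma cp_conj n m (W : 'M[C]_(m, n)) : cpmap (fun X => W *m X *m W ^t*).
Proof.
split=> [a X Y|k X pX w]; first by rewrite mulmxDr mulmxDl -scalemxAr -scalemxAl.
have := pX (fun i => W ^t* *m w i).
rewrite (eq_bigr (fun i => \sum_j ((w i) ^t* *m (W *m X i j *m W ^t*) *m w j) 0 0)) // => i _.
by apply: eq_bigr => j _; rewrite trmx_mul map_mxM trmxCK !mulmxA.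
Qed.

Lemma cp_sum n m (I : finType) (F : I -> 'M[C]_n -> 'M[C]_m) :
  (forall i, cpmap (F i)) -> cpmap (fun X => \sum_i F i X).
Proof.
move=> cF; split=> [a X Y|k X pX w].
  by rewrite scaler_sumr -big_split; apply: eq_bigr => i _; rewrite (cF i).1.
have -> : \sum_i \sum_j ((w i) ^t* *m (\sum_r F r (X i j)) *m w j) 0 0 =
   \sum_r \sum_i \sum_j ((w i) ^t* *m F r (X i j) *m w j) 0 0.
  rewrite [RHS]exchange_big /=; apply: eq_bigr => i _.
  rewrite [RHS]exchange_big /=; apply: eq_bigr => j _.
  by rewrite mulmx_sumr mulmx_suml summxE.
by apply: sumr_ge0 => r _; apply: (cF r).2.
Qed.

Lemma cp_add n m (S T : 'M[C]_n -> 'M[C]_m) :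
  cpmap S -> cpmap T -> cpmap (fun X => S X + T X).
Proof.
move=> cS cT; have := @cp_sum n m bool (fun b => if b then S else T).
under eq_fun do rewrite big_bool /=.
by apply; case.
Qed.

Lemma cp_ext n m (S T : 'M[C]_n -> 'M[C]_m) : S =1 T -> cpmap S -> cpmap T.
Proof. by move=> /funext ->. Qed.

(** This is n times the projector onto the maximally entangled vector; its form at [w] is |sum_i
    (w_i)_i|^2. *)
Lemma posblk_delta n : posblk (fun i j : 'I_n => delta_mx i j : 'M[C]_n).
Proof.
move=> w.
have -> : \sum_i \sum_j ((w i) ^t* *m delta_mx i j *m w j) 0 0 =
   (\sum_i w i i 0)^* * (\sum_i w i i 0).
  rewrite rmorph_sum mulr_suml; apply: eq_bigr => i _.
  rewrite mulr_sumr; apply: eq_bigr => j _.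
  rewrite -(mul_delta_mx (0 : 'I_1)) mulmxA -mulmxA mxE big_ord1.
  by rewrite -colE -rowE !mxE.
by rewrite mulrC -normCK exprn_ge0.
Qed.

Lemma cp_choi n m (T : 'M[C]_n -> 'M[C]_m) : cpmap T ->
  posker (fun p q : 'I_n * 'I_m => T (delta_mx p.1 q.1) p.2 q.2).
Proof.
move=> [_ pT]; have [H _] := posblkP (fun i j => T (delta_mx i j)).
exact/H/pT/posblk_delta.
Qed.

Lemma cp_diag_ge0 n m (T : 'M[C]_n -> 'M[C]_m) i c :
  cpmap T -> 0 <= T (delta_mx i i) c c.
Proof. by move=> /cp_choi/posker_ge0/(_ (i, c)). Qed.

Lemma cp_posker n m (T : 'M[C]_n -> 'M[C]_m) (X : 'M[C]_n) :
  cpmap T -> posker (fun i j => X i j) -> posker (fun i j => T X i j).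
Proof.
move=> [_ pT] pX.
have [H1 _] := posblkP (fun _ _ : 'I_1 => T X).
have [_ H2] := posblkP (fun _ _ : 'I_1 => X).
have := H1 (pT _ _ (H2 (posker_comp snd pX))).
by move=> /(posker_comp (fun a => (0 : 'I_1, a))).
Qed.

Lemma posker_trace_ge0 n (A : 'M[C]_n) : posker (fun i j => A i j) -> 0 <= \tr A.
Proof. by move=> pA; apply: sumr_ge0 => i _; apply: posker_ge0 pA _. Qed.

Lemma mxtrace_delta n (i j : 'I_n) : \tr (delta_mx i j : 'M[C]_n) = (i == j)%:R.
Proof.
rewrite /mxtrace (bigD1 i) //= big1 ?addr0 => [|k /negbTE ki]; rewrite mxE ?eqxx //.
by rewrite ki.
Qed.

Lemma posker_delta n (i : 'I_n) : posker (fun a b => (delta_mx i i : 'M[C]_n) a b).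
Proof.
have [H _] := posblkP (fun i j : 'I_n => delta_mx i j : 'M[C]_n).
exact: (posker_comp (fun a => (i, a)) (H (@posblk_delta n))).
Qed.

(** Trace preservation puts the diagonal of the Choi matrix in [0, 1], and its minors bound the
    other entries. The bound is the same for all channels, so it holds for all powers of one channel
    at once. *)
Lemma cptp_entry_le1 n m (T : 'M[C]_n -> 'M[C]_m) a b c e :
  cptp T -> `|T (delta_mx a b) c e| <= 1.
Proof.
move=> [cT tT]; have le1 i j : T (delta_mx i i) j j <= 1.
  have <- : \tr (T (delta_mx i i)) = 1 by rewrite tT mxtrace_delta eqxx.
  rewrite /mxtrace (bigD1 j) //= lerDl sumr_ge0 // => k _.
  exact: cp_diag_ge0.
have /= := posker_minor (cp_choi cT) (a, c) (b, e).
move=> H; rewrite -(ler_pXn2r (isT : (0 < 2)%N)) ?nnegrE // expr1n.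
apply: le_trans H _; rewrite -[leRHS]mulr1.
by apply: ler_pM; rewrite ?cp_diag_ge0.
Qed.

Definition mxnorm1 n m (X : 'M[C]_(n, m)) : C := \sum_a \sum_b `|X a b|.

Lemma mxnorm1_ge0 n m (X : 'M[C]_(n, m)) : 0 <= mxnorm1 X.
Proof. by apply: sumr_ge0 => a _; apply: sumr_ge0. Qed.

Lemma cptp_entry_le n m (T : 'M[C]_n -> 'M[C]_m) X c e :
  cptp T -> `|T X c e| <= mxnorm1 X.
Proof.
move=> cT; rewrite (mxlinE cT.1.1) summxE.
apply: le_trans (ler_norm_sum _ _ _) _; apply: ler_sum => a _.
rewrite summxE; apply: le_trans (ler_norm_sum _ _ _) _; apply: ler_sum => b _.
rewrite mxE normrM -[leRHS]mulr1.
by apply: ler_wpM2l => //; apply: cptp_entry_le1.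
Qed.

(** [G (Y i) i i] pairs [Y i] with the kernel G(e_pq)_ii, so it is at most sum_a G(e_aa)_ii. Summed
    over i this becomes the trace of G(e_aa), which is 1 for each of the m values of a. *)
Lemma classical_bound D m (G : 'M[C]_m -> 'M[C]_D) (Y : 'I_D -> 'M[C]_m) :
  cptp G -> (forall i, posker (fun a b => Y i a b)) -> (forall i, \tr (Y i) <= 1) ->
  `|\sum_i G (Y i) i i| <= m%:R.
Proof.
move=> [cG tG] pY tY.
apply: le_trans (ler_norm_sum _ _ _) _.
apply: le_trans (_ : \sum_i \sum_a G (delta_mx a a) i i <= _); last first.
  rewrite exchange_big /= -[X in _ <= X%:R]card_ord -sum1_card natr_sum.
  apply: ler_sum => a _; have := tG (delta_mx a a).
  by rewrite mxtrace_delta eqxx /mxtrace => ->.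
apply: ler_sum => i _.
have := posker_sum_mul_le (pY i) (posker_comp (fun a => (a, i)) (cp_choi cG)).
rewrite /= => H.
have E : \sum_p \sum_q Y i p q * G (delta_mx p q) i i = G (Y i) i i.
  rewrite [in RHS](mxlinE cG.1) summxE; apply: eq_bigr => p _.
  by rewrite summxE; apply: eq_bigr => q _; rewrite mxE.
rewrite E in H; apply: le_trans H _; rewrite -[leRHS]mul1r.
apply: ler_wpM2r; last exact: tY.
by apply: sumr_ge0 => a _; apply: cp_diag_ge0.
Qed.

(** D^2 times the entanglement fidelity, see [maxent_fidelity]. *)
Definition unnorm_fidelity D (T : 'M[C]_D -> 'M[C]_D) : C :=
  \sum_i \sum_j T (delta_mx i j) i j.

(** Swapping the pairs aligns the input of [G] with the output of [F]. The Choi matrix of [G] has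
    trace m; that of [F] stays in the statement, so that the weights of several blocks can be added
    later. *)
Lemma quantum_bound D m (G : 'M[C]_m -> 'M[C]_D) (F : 'M[C]_D -> 'M[C]_m) :
  cptp G -> cpmap F ->
  `|unnorm_fidelity (G \o F)| <= m%:R * \sum_i \tr (F (delta_mx i i)).
Proof.
move=> [cG tG] cF.
have := posker_sum_mul_le (cp_choi cF)
  (posker_comp (fun p : 'I_D * 'I_m => (p.2, p.1)) (cp_choi cG)).
have -> : \sum_(p : 'I_D * 'I_m) G (delta_mx p.2 p.2) p.1 p.1 = m%:R.
  rewrite -(pair_bigA _ (fun i a => G (delta_mx a a) i i)) /= exchange_big /=.
  rewrite -[X in _ = X%:R]card_ord -sum1_card natr_sum.
  apply: eq_bigr => a _; have := tG (delta_mx a a).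
  by rewrite mxtrace_delta eqxx /mxtrace => ->.
have -> : \sum_(p : 'I_D * 'I_m) F (delta_mx p.1 p.1) p.2 p.2 =
     \sum_i \tr (F (delta_mx i i)).
  by rewrite -(pair_bigA _ (fun i a => F (delta_mx i i) a a)).
suff -> : \sum_(p : 'I_D * 'I_m) \sum_(q : 'I_D * 'I_m)
    F (delta_mx p.1 q.1) p.2 q.2 * G (delta_mx p.2 q.2) p.1 q.1 =
    unnorm_fidelity (G \o F) by rewrite mulrC.
rewrite -(pair_bigA _ (fun i a => \sum_(q : 'I_D * 'I_m)
    F (delta_mx i q.1) a q.2 * G (delta_mx a q.2) i q.1)) /=.
apply: eq_bigr => i _; rewrite exchange_big /=.
rewrite -(pair_bigA _ (fun j b => \sum_a F (delta_mx i j) a b * G (delta_mx a b) i j)) /=.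
apply: eq_bigr => j _; rewrite [in RHS](mxlinE cG.1) summxE exchange_big /=.
apply: eq_bigr => a _; rewrite summxE; apply: eq_bigr => b _.
by rewrite mxE.
Qed.

Lemma fidelity_ge0 D (T : 'M[C]_D -> 'M[C]_D) : cpmap T -> 0 <= unnorm_fidelity T.
Proof.
move=> [_ pT]; have := pT _ _ (@posblk_delta D) (fun i => delta_mx i 0).
rewrite /unnorm_fidelity => H; apply: le_trans H _.
rewrite le_eqVlt; apply/orP; left; apply/eqP.
apply: eq_bigr => i _; apply: eq_bigr => j _.
have -> : (delta_mx i 0 : 'cV[C]_D) ^t* = delta_mx 0 i.
  by apply/matrixP => x y; rewrite !mxE conjC_nat andbC.
by rewrite -rowE -colE !mxE.
Qed.

(** Supplies Kraus operators for tensoring with the density operators [omega k]. *)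
Lemma psd_factor n (A : 'M[C]_n) : A ^t* = A ->
  (forall v : 'cV[C]_n, 0 <= (v ^t* *m A *m v) 0 0) ->
  exists B : 'M[C]_n, A = B *m B ^t*.
Proof.
move=> hA pA.
have /orthomx_spectralP E : A \is normalmx by apply/normalmxP; rewrite hA.
set P := spectralmx A in E; set sp := spectral_diag A in E.
have uP : P \is unitarymx by apply: spectral_unitarymx.
rewrite invmx_unitary // in E.
have PP : P *m P ^t* = 1%:M by apply/unitarymxP.
have spE : diag_mx sp = P *m A *m P ^t*.
  by rewrite E !mulmxA PP mul1mx -mulmxA PP mulmx1.
have sp0 i : 0 <= sp 0 i.
  have := pA (P ^t* *m delta_mx i 0).
  rewrite trmx_mul map_mxM trmxCK.
  have -> : (delta_mx i 0 : 'cV[C]_n) ^t* = delta_mx 0 i.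
    by apply/matrixP => x y; rewrite !mxE conjC_nat andbC.
  rewrite -!mulmxA (mulmxA A) (mulmxA P) [P *m (A *m _)]mulmxA -spE -rowE -colE.
  by rewrite !mxE eqxx mulr1n.
exists (P ^t* *m diag_mx (\row_i sqrtC (sp 0 i))).
rewrite trmx_mul map_mxM trmxCK {1}E !mulmxA; congr (_ *m _).
rewrite -!mulmxA; congr (_ *m _).
rewrite tr_diag_mx map_diag_mx mulmx_diag; congr diag_mx.
apply/rowP => i; rewrite !mxE.
transitivity (sqrtC (sp 0 i) * sqrtC (sp 0 i)); first by rewrite -expr2 sqrtCK.
by congr (_ * _); symmetry; apply/CrealP; rewrite ger0_real ?sqrtC_ge0.
Qed.

End CompletelyPositive.

(** * Splitting a matrix into a peripheral and a decaying part *)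

Section PeripheralDecomposition.
Variable R : realType.
Local Notation C := R[i].

(** Serves to undo a factor T - r with |r| < 1: [e] measures the orbit of the old remainder, [a]
    that of the new one. *)
Lemma cvg0_contraction (rho : R) (a e : nat -> R) :
  0 <= rho < 1 -> (forall n, 0 <= a n) ->
  (forall n, a n.+1 <= rho * a n + e n) ->
  e @ \oo --> (0 : R) -> a @ \oo --> (0 : R).
Proof.
move=> /andP[rho0 rho1] a0 ae e0.
apply/cvgr0Pnorm_le => eps eps0.
(* With this bound on [e], the number eps / 2 is a fixed point of the recursion, which is what
   [bound] needs. *)
have eps' : 0 < eps / 2 * (1 - rho) by rewrite mulr_gt0 ?divr_gt0 // subr_gt0.
move/cvgr0Pnorm_le/(_ _ eps') : e0 => [M _ HM].
have bound k : a (M + k)%N <= rho ^+ k * a M + eps / 2.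
  elim: k => [|k IH]; first by rewrite addn0 expr0 mul1r lerDl ltW // divr_gt0.
  rewrite addnS; apply: le_trans (ae _) _.
  have /HM/= h : (M <= M + k)%N by apply: leq_addr.
  have := ler_wpM2l rho0 IH; rewrite exprS.
  have := le_trans (ler_norm _) h; lra.
have : (fun k => rho ^+ k * a M) @ \oo --> (0 : R).
  rewrite -(mul0r (a M)); apply: cvgMl.
  by apply: cvg_expr; rewrite ger0_norm.
have eps2 : 0 < eps / 2 by rewrite divr_gt0.
move=> /cvgr0Pnorm_le/(_ _ eps2) [N _ HN].
exists (M + N)%N => //= n /= Mn.
have nE : (n = M + (n - M))%N by rewrite subnKC // (leq_trans _ Mn) ?leq_addr.
have /HN/= h : (N <= n - M)%N by rewrite leq_subRL ?(leq_trans _ Mn) ?leq_addr.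
rewrite ger0_norm // nE; apply: le_trans (bound _) _.
have := le_trans (ler_norm _) h; lra.
Qed.

Lemma realCM (x y : R) : (x * y)%:C%C = x%:C%C * y%:C%C. Proof. exact: rmorphM. Qed.
Lemma realCD (x y : R) : (x + y)%:C%C = x%:C%C + y%:C%C. Proof. exact: rmorphD. Qed.
Lemma realCX (x : R) n : (x ^+ n)%:C%C = x%:C%C ^+ n. Proof. exact: rmorphXn. Qed.
Lemma realCn n : (n%:R : R)%:C%C = n%:R. Proof. exact: rmorph_nat. Qed.

Definition rnorm n m (X : 'M[C]_(n, m)) : R := complex.Re (mxnorm1 X).

Lemma rnormE n m (X : 'M[C]_(n, m)) : (rnorm X)%:C%C = mxnorm1 X.
Proof. by apply: RRe_real; apply: ger0_real; apply: mxnorm1_ge0. Qed.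

Lemma rnorm_ge0 n m (X : 'M[C]_(n, m)) : 0 <= rnorm X.
Proof. by rewrite -ler0c rnormE mxnorm1_ge0. Qed.

Lemma rnormD n m (X Y : 'M[C]_(n, m)) : rnorm (X + Y) <= rnorm X + rnorm Y.
Proof.
rewrite -lecR realCD !rnormE /mxnorm1 -big_split /=.
apply: ler_sum => a _; rewrite -big_split /=; apply: ler_sum => b _.
by rewrite mxE ler_normD.
Qed.

Lemma mxnorm1Z n m c (X : 'M[C]_(n, m)) : mxnorm1 (c *: X) = `|c| * mxnorm1 X.
Proof.
rewrite /mxnorm1 mulr_sumr; apply: eq_bigr => a _.
by rewrite mulr_sumr; apply: eq_bigr => b _; rewrite mxE normrM.
Qed.

Lemma normc_Re (c : C) : `|c| = (complex.Re `|c|)%:C%C.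
Proof. by rewrite RRe_real ?normr_real. Qed.

Lemma rnormZ n m c (X : 'M[C]_(n, m)) : rnorm (c *: X) = complex.Re `|c| * rnorm X.
Proof.
apply: complexI; by rewrite rnormE mxnorm1Z realCM rnormE -normc_Re.
Qed.

Lemma rnormN n m (X : 'M[C]_(n, m)) : rnorm (- X) = rnorm X.
Proof. by rewrite -scaleN1r rnormZ normrN1 mul1r. Qed.

Lemma rnorm_eq0 n m (X : 'M[C]_(n, m)) : rnorm X <= 0 -> X = 0.
Proof.
move=> X0; have : mxnorm1 X = 0.
  by rewrite -rnormE; have/eqP-> : rnorm X == 0 by rewrite eq_le X0 rnorm_ge0.
move=> H; apply/matrixP => a b; rewrite mxE; apply/eqP.
move: H; rewrite /mxnorm1 => /eqP; rewrite psumr_eq0 => [/allP/(_ a)|i _]; last exact: sumr_ge0.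
rewrite mem_index_enum => /(_ isT) /=; rewrite psumr_eq0 // => /allP/(_ b).
by rewrite mem_index_enum normr_eq0 => /(_ isT).
Qed.

Lemma cptp_rnorm n m (T : 'M[C]_n -> 'M[C]_m) X :
  cptp T -> rnorm (T X) <= (m * m)%:R * rnorm X.
Proof.
move=> cT; rewrite -lecR realCM realCn !rnormE {1}/mxnorm1.
apply: le_trans (_ : \sum_(a < m) \sum_(b < m) mxnorm1 X <= _).
  by apply: ler_sum => a _; apply: ler_sum => b _; apply: cptp_entry_le.
by rewrite !sumr_const !card_ord -mulrnA mulr_natl.
Qed.

(** Cayley-Hamilton with the factors in any order, so that the roots can be sorted by modulus. *)
Lemma foldl_char_poly_roots N (A : 'M[C]_N) : exists rs : seq C,
  forall rs', perm_eq rs' rs -> forall x : 'rV[C]_N,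
    foldl (fun x r => x *m A - r *: x) x rs' = 0.
Proof.
case: N A => [|N] A; first by exists [::] => rs' _ x; apply/matrixP => ? [].
have [rs rsE] := closed_field_poly_normal (char_poly A).
exists rs => rs' prs x.
have E (s : seq C) (y : 'rV[C]_N.+1) :
    foldl (fun x r => x *m A - r *: x) y s =
    y *m horner_mx A (\prod_(z <- s) ('X - z%:P)).
  elim: s y => [|r s IH] y /=; first by rewrite big_nil rmorph1 mulmx1.
  rewrite IH big_cons rmorphM /= rmorphB /= horner_mx_X horner_mx_C.
  by rewrite -mulmxE mulmxA mulmxBr mul_mx_scalar.
rewrite E (perm_big _ prs) /=.
have := Cayley_Hamilton A; rewrite rsE (monicP (char_poly_monic A)) scale1r => ->.
by rewrite mulmx0.
Qed.

Variables (d : nat) (T : 'M[C]_d -> 'M[C]_d).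
Hypothesis cT : cptp T.
Let lT : mxlinear T := cT.1.1.
Let P : set 'M[C]_d := peripheral (T : linmap R d d).

Lemma peripheral_sum (I : finType) (c lam : I -> C) (Y : I -> 'M[C]_d) (Q : pred I) :
  (forall i, `|lam i| = 1 /\ T (Y i) = lam i *: Y i) -> P (\sum_(i | Q i) c i *: Y i).
Proof.
move=> HY; exists #|I|, (fun i => if Q (enum_val i) then c (enum_val i) else 0),
  (fun i => lam (enum_val i)), (fun i => Y (enum_val i)); split=> [i|]; first exact: HY.
rewrite big_mkcond (reindex (@enum_val I I)) /=; last first.
  by apply: onW_bij; apply: enum_val_bij.
by apply: eq_bigr => i _; case: ifP => _; rewrite ?scale0r.
Qed.

Lemma peripheralD X Y : P X -> P Y -> P (X + Y).
Proof.
move=> [n [c [l [U [HU ->]]]]] [m [c' [l' [V [HV ->]]]]].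
have := @peripheral_sum ('I_n + 'I_m)%type
  (fun i => match i with inl i => c i | inr i => c' i end)
  (fun i => match i with inl i => l i | inr i => l' i end)
  (fun i => match i with inl i => U i | inr i => V i end) xpredT.
rewrite big_sumType /=; apply; by case.
Qed.

Lemma peripheral_eigen lam Y : `|lam| = 1 -> T Y = lam *: Y -> P Y.
Proof.
move=> l1 TY; have := @peripheral_sum 'I_1 (fun _ => 1) (fun _ => lam) (fun _ => Y) xpredT.
by rewrite big_ord1 scale1r; apply.
Qed.

Lemma peripheral0 : P 0.
Proof.
have := @peripheral_sum 'I_0 (fun _ => 1) (fun _ => 1) (fun _ => 0) xpredT.
by rewrite big_ord0; apply; case.
Qed.

(** On eigenvalues other than [r] one divides by the difference. The component [U] with eigenvalue
    [r] is the obstruction to solving (T - r) V = Y. *)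
Lemma peripheral_solve r Y : P Y -> exists V U,
  [/\ P V, T V - r *: V = Y - U, T U = r *: U & `|r| != 1 -> U = 0].
Proof.
move=> [n [c [l [Z [HZ ->]]]]].
exists (\sum_(i | l i != r) (c i / (l i - r)) *: Z i), (\sum_(i | l i == r) c i *: Z i).
split.
- exact: peripheral_sum HZ.
- rewrite [X in _ = X - _](bigID (fun i => l i == r)) /= [X in _ = X - _]addrC addrK.
  rewrite (mxlin_sum lT) scaler_sumr -sumrB; apply: eq_bigr => i lr.
  rewrite (mxlinZ lT) (HZ i).2 !scalerA -scalerBl; congr (_ *: _).
  by rewrite [r * _]mulrC -mulrBr divfK // subr_eq0.
- rewrite (mxlin_sum lT) scaler_sumr; apply: eq_bigr => i /eqP lr.
  by rewrite (mxlinZ lT) (HZ i).2 lr !scalerA mulrC.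
- move=> r1; rewrite big_pred0 // => i; apply/negbTE; apply: contraNneq r1 => <-.
  by rewrite (HZ i).1.
Qed.

Let act (rs : seq C) X := foldl (fun X r => T X - r *: X) X rs.

Lemma subr_eigen r X V :
  T (X - V) - r *: (X - V) = (T X - r *: X) - (T V - r *: V).
Proof.
rewrite (mxlinB lT) scalerBr !opprB addrACA [RHS]addrACA.
by congr (_ + _); rewrite addrC.
Qed.

Lemma iter_jordan2 r W U : T W - r *: W = U -> T U = r *: U ->
  forall n, iter n.+1 T W = r ^+ n.+1 *: W + (n.+1%:R * r ^+ n) *: U.
Proof.
move=> TW TU; have TWE : T W = r *: W + U by rewrite -TW addrC subrK.
elim=> [|n IH]; first by rewrite /= TWE expr1 expr0 mulr1 scale1r.
rewrite iterS IH (mxlinD lT) !(mxlinZ lT) TWE TU scalerDr !scalerA -addrA -scalerDl.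
congr (_ *: _ + _ *: _); first by rewrite -exprSr.
by rewrite exprS [n.+2%:R]mulrS; ring.
Qed.

(* An eigenvalue outside the open disc is unimodular and semisimple because
   the iterates of a channel are uniformly bounded. *)
Lemma act_outer_peripheral rs X :
  all (fun r => 1 <= `|r|) rs -> act rs X = 0 -> P X.
Proof.
elim: rs X => [|r rs IH] X /=; first by move=> _ ->; apply: peripheral0.
move=> /andP[r1 rs1] /IH - /(_ rs1) PX'.
have [V [U [PV VE TU U0]]] := peripheral_solve r PX'.
pose W := X - V; pose K : R := (d * d)%:R.
have XE : X = V + W by rewrite addrC subrK.
have TW : T W - r *: W = U.
  by rewrite /W subr_eigen VE opprB addrC subrK.
suff PW : P W by rewrite XE; apply: peripheralD.
have itb n : rnorm (iter n T W) <= K * rnorm W by apply: cptp_rnorm; apply: cptp_iter.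
have itE := iter_jordan2 TW TU.
set q := complex.Re `|r|.
have rq : `|r| = q%:C%C by apply: normc_Re.
have q1 : 1 <= q by rewrite -lecR -rq.
have [r_eq|r_neq] := eqVneq `|r| 1.
  (* With |r| = 1, a nonzero [U] would make the orbit of [W] grow linearly, against [itb]. *)
  have U00 : U = 0.
    apply: rnorm_eq0; rewrite leNgt; apply/negP => U_gt0.
    have b n : n.+1%:R * rnorm U <= (K + 1) * rnorm W.
      have -> : n.+1%:R * rnorm U = rnorm (iter n.+1 T W - r ^+ n.+1 *: W).
        rewrite itE addrC addKr rnormZ normrM normrX r_eq expr1n mulr1 normr_nat.
        by rewrite -realCn.
      apply: le_trans (rnormD _ _) _; rewrite rnormN rnormZ normrX r_eq expr1n.
      by rewrite mulrDl lerD2r; apply: itb.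
    have := archi_boundP (_ : 0 <= (K + 1) * rnorm W / rnorm U).
    rewrite ltr_pdivrMr // => /(_ _) H.
    have {H} := H _; rewrite divr_ge0 ?mulr_ge0 ?addr_ge0 ?ler0n ?rnorm_ge0 // => /(_ isT).
    apply/negP; rewrite -leNgt; apply: le_trans (b (Num.bound ((K + 1) * rnorm W / rnorm U))).
    by rewrite ler_wpM2r ?rnorm_ge0 // ler_nat.
  apply: peripheral_eigen r_eq _; apply/eqP; rewrite -subr_eq0 TW; exact/eqP.
have q_gt1 : 1 < q.
  rewrite lt_neqAle q1 andbT; apply: contra r_neq => /eqP q_eq.
  by rewrite rq -q_eq.
(* Now |r| > 1 and [U] is 0, so the orbit of a nonzero [W] grows like q^n, which exceeds [K] by
   Bernoulli's inequality. *)
suff -> : W = 0 by apply: peripheral0.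
apply: rnorm_eq0; rewrite leNgt; apply/negP => W0.
have b n : q ^+ n.+1 <= K.
  have := itb n.+1; rewrite itE U0 // scaler0 addr0 rnormZ normrX rq.
  by rewrite -realCX ler_pM2r.
have bern n : 1 + (q - 1) *+ n <= q ^+ n.
  elim: n => [|n IHn]; first by rewrite mulr0n addr0 expr0.
  rewrite exprS mulrS; have /(ler_wpM2l (ltW (lt_trans ltr01 q_gt1))) := IHn.
  have : 0 <= (q - 1) *+ n by rewrite mulrn_wge0 // subr_ge0.
  nra.
have := archi_boundP (_ : 0 <= K / (q - 1)).
rewrite ltr_pdivrMr ?subr_gt0 // => H.
have {H} := H (divr_ge0 (ler0n _ _) (ltW _)); rewrite subr_gt0 => /(_ q_gt1).
apply/negP; rewrite -leNgt; set N := Num.bound _.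
have := le_trans (bern N.+1) (b N); rewrite mulrS -mulr_natl.
have : 0 <= q - 1 by rewrite subr_ge0.
lra.
Qed.

(** If T X - r X splits as Y' plus a decaying Z', solve (T - r) V = Y', without obstruction as |r| <
    1. Then T (X - V) = r (X - V) + Z', and X - V decays too. *)
Lemma act_decomposition ss rs X : all (fun r => `|r| < 1) ss ->
  all (fun r => 1 <= `|r|) rs -> act (ss ++ rs) X = 0 ->
  exists2 Y, P Y & (fun n => rnorm (iter n T (X - Y))) @ \oo --> (0 : R).
Proof.
move=> + rs1; elim: ss X => [|r ss IH] X /=.
  move=> _ /(act_outer_peripheral rs1) PX; exists X => //.
  rewrite subrr; under eq_fun => n.
    rewrite (_ : iter n T 0 = 0); last by elim: n => //= n ->; apply: mxlin0.
    rewrite (_ : rnorm 0 = 0); last by rewrite -(scale0r 0) rnormZ normr0 mul0r.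
    over.
  exact: cvg_cst.
move=> /andP[r1 ss1] /IH - /(_ ss1)[Y' PY' cvgY'].
have [V [U [PV VE _ U0]]] := peripheral_solve r PY'.
exists V => //.
rewrite U0 ?lt_eqF // subr0 in VE.
set Z' := _ - Y' in cvgY'.
have rq := normc_Re r.
apply: (cvg0_contraction (rho := complex.Re `|r|)) cvgY'.
- by rewrite -ler0c -ltcR -rq normr_ge0.
- by move=> n; apply: rnorm_ge0.
move=> n; rewrite iterSr.
have -> : T (X - V) = r *: (X - V) + Z'.
  by rewrite /Z' -VE -subr_eigen [RHS]addrC subrK.
have cn := cptp_iter n cT.
rewrite (mxlinD cn.1.1) (mxlinZ cn.1.1).
by apply: le_trans (rnormD _ _) _; rewrite rnormZ.
Qed.

Lemma peripheral_decomposition X :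
  exists2 Y, P Y & (fun n => rnorm (iter n T (X - Y))) @ \oo --> (0 : R).
Proof.
pose L : {linear 'M[C]_d -> 'M[C]_d} := HB.pack T (GRing.isLinear.Build _ _ _ _ T lT).
have [rs rsP] := foldl_char_poly_roots (lin_mx L).
pose sm (r : C) := `|r| < 1.
apply: (@act_decomposition [seq r <- rs | sm r] [seq r <- rs | ~~ sm r]).
- by apply/allP => r; rewrite mem_filter => /andP[].
- apply/allP => r; rewrite mem_filter => /andP[+ _].
  by rewrite /sm -real_leNgt ?normr_real ?real1.
have /rsP/(_ (mxvec X)) : perm_eq ([seq r <- rs | sm r] ++ [seq r <- rs | ~~ sm r]) rs.
  by rewrite perm_filterC.
move: (_ ++ _) => s.
have -> : foldl (fun x r => x *m lin_mx L - r *: x) (mxvec X) s = mxvec (act s X).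
  elim: s X => //= r s IH X; rewrite -[RHS](IH (T X - r *: X)).
  congr (foldl _ _ _); rewrite [in RHS]linearB [in RHS]linearZ /=.
  congr (_ - _); exact: (mul_vec_lin L).
by move/(congr1 vec_mx); rewrite mxvecK linear0.
Qed.

End PeripheralDecomposition.

(** * Limits of channels along an ultrafilter *)

Section UltrafilterLimits.
Variable R : realType.
Local Notation C := R[i].
Variable F : set_system nat.
Hypothesis UF : UltraFilter F.
Hypothesis ooF : \oo `<=` F.
Local Instance FP : ProperFilter F := @ultra_proper _ _ UF.

(** A cluster point exists by compactness and is a limit: if a neighbourhood of it had its preimage
    outside [F], the complement would be in [F], and the two would have to meet. *)
Lemma cvg_ultra_bounded (u : nat -> R) M :
  (forall n, `|u n| <= M) -> exists l, u @ F --> (l : R).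
Proof.
move=> uM; have := @segment_compact R (- M) M.
move=> /(_ (u @ F) _) [|l [_ cl]].
  by apply: (@filterS _ F _ setT) filterT => n _ /=; rewrite in_itv /= -ler_norml.
exists l => N Nl /=.
have [//|FN] := in_ultra_setVsetC (u @^-1` N) UF.
have [x [/= Nx nNx]] : (~` N) `&` N !=set0 by apply: cl.
by [].
Qed.

Definition ccvg (u : nat -> C) (l : C) : Prop :=
  ((fun n => complex.Re (u n)) @ F --> (complex.Re l : R)) /\
  ((fun n => complex.Im (u n)) @ F --> (complex.Im l : R)).

Lemma ccvg_unique u l l' : ccvg u l -> ccvg u l' -> l = l'.
Proof.
move=> [H1 H2] [H1' H2']; apply/eqP; rewrite eq_complex.
by rewrite (cvg_unique _ H1 H1') // (cvg_unique _ H2 H2') // !eqxx.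
Qed.

Lemma ccvg_cst c : ccvg (fun _ => c) c.
Proof. by split; apply: cvg_cst. Qed.

Lemma ccvgD u v l l' : ccvg u l -> ccvg v l' -> ccvg (fun n => u n + v n) (l + l').
Proof.
move=> [H1 H2] [H1' H2']; split.
  rewrite (_ : (fun n => _) = (fun n => complex.Re (u n) + complex.Re (v n))).
    by rewrite raddfD; apply: cvgD.
  by apply/funext => n; rewrite raddfD.
rewrite (_ : (fun n => _) = (fun n => complex.Im (u n) + complex.Im (v n))).
  by rewrite raddfD; apply: cvgD.
by apply/funext => n; rewrite raddfD.
Qed.

Lemma ccvgM u v l l' : ccvg u l -> ccvg v l' -> ccvg (fun n => u n * v n) (l * l').
Proof.
have ReM (x y : C) : complex.Re (x * y) =
    complex.Re x * complex.Re y - complex.Im x * complex.Im y by case: x y => [? ?] [].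
have ImM (x y : C) : complex.Im (x * y) =
    complex.Re x * complex.Im y + complex.Im x * complex.Re y by case: x y => [? ?] [].
move=> [H1 H2] [H1' H2']; split.
  by rewrite ReM (funext (fun n => ReM (u n) (v n))); apply: cvgB; apply: cvgM.
by rewrite ImM (funext (fun n => ImM (u n) (v n))); apply: cvgD; apply: cvgM.
Qed.

Lemma ccvg_conj u l : ccvg u l -> ccvg (fun n => (u n)^*) l^*.
Proof.
have ReJ (x : C) : complex.Re x^* = complex.Re x by case: x.
have ImJ (x : C) : complex.Im x^* = - complex.Im x by case: x.
move=> [H1 H2]; split.
  by rewrite ReJ (funext (fun n => ReJ (u n))).
by rewrite ImJ (funext (fun n => ImJ (u n))); apply: cvgN.
Qed.

Lemma ccvg_sum (I : finType) (u : I -> nat -> C) (l : I -> C) :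
  (forall i, ccvg (u i) (l i)) -> ccvg (fun n => \sum_i u i n) (\sum_i l i).
Proof.
move=> H; elim: (index_enum I) => [|i r IH].
  rewrite big_nil; under eq_fun => n do rewrite big_nil; exact: ccvg_cst.
rewrite big_cons; under eq_fun => n do rewrite big_cons; exact: ccvgD.
Qed.

Lemma ccvg_ge0 u l : (forall n, 0 <= u n) -> ccvg u l -> 0 <= l.
Proof.
move=> u0 [H1 H2].
have u0' n : complex.Im (u n) = 0 /\ 0 <= complex.Re (u n).
  by have := u0 n; rewrite lecE /= => /andP[/eqP -> ->].
rewrite lecE /=; apply/andP; split.
  apply/eqP; apply: (cvg_unique _ H2) => //.
  by rewrite (funext (fun n => (u0' n).1)); apply: cvg_cst.
apply: (cvgr_to_ge H1).
by apply: (@filterS _ F _ setT) filterT => n _; apply: (u0' n).2.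
Qed.

Lemma Re_Im_le_norm (z : C) : `|complex.Re z| <= complex.Re `|z| /\ `|complex.Im z| <= complex.Re `|z|.
Proof.
have H (x : C) : `|complex.Re x| <= complex.Re `|x|.
  by rewrite -lecR -normc_Re normc_ge_Re.
split=> //; have := H ('i%C * z).
by rewrite normrM complexiE normCi mul1r -complexiE mulrC ReiNIm normrN.
Qed.

Lemma ccvg_bounded (u : nat -> C) M : (forall n, `|u n| <= M) -> exists l, ccvg u l.
Proof.
move=> uM; have MR n : complex.Re `|u n| <= complex.Re M.
  by have := uM n; rewrite lecE => /andP[].
have [a Ha] : exists l, (fun n => complex.Re (u n)) @ F --> (l : R).
  apply: (cvg_ultra_bounded (M := complex.Re M)) => n.
  by apply: le_trans (MR n); have [] := Re_Im_le_norm (u n).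
have [b Hb] : exists l, (fun n => complex.Im (u n)) @ F --> (l : R).
  apply: (cvg_ultra_bounded (M := complex.Re M)) => n.
  by apply: le_trans (MR n); have [] := Re_Im_le_norm (u n).
by exists (Complex a b).
Qed.

Lemma ccvg_near u v l : F [set n | u n = v n] -> ccvg v l -> ccvg u l.
Proof.
move=> uv [H1 H2]; split.
  apply: cvg_trans H1; apply: near_eq_cvg; apply: filterS uv => n /= ->; by [].
apply: cvg_trans H2; apply: near_eq_cvg; apply: filterS uv => n /= ->; by [].
Qed.

(** For each input the entries are bounded uniformly over channels, and the conditions on a channel
    are equations and weak inequalities, which survive limits. *)
Lemma ccvg_cptp n m (S : nat -> 'M[C]_n -> 'M[C]_m) :
  (forall k, cptp (S k)) -> exists L, cptp L /\
    forall X i j, ccvg (fun k => S k X i j) (L X i j).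
Proof.
move=> cS.
have ex X (ij : 'I_m * 'I_m) : exists l, ccvg (fun k => S k X ij.1 ij.2) l.
  apply: (ccvg_bounded (M := mxnorm1 X)) => k; exact: cptp_entry_le.
have [L LP] : exists L : 'M[C]_n -> 'M[C]_m,
    forall X i j, ccvg (fun k => S k X i j) (L X i j).
  exists (fun X => \matrix_(i, j) projT1 (cid (ex X (i, j)))) => X i j.
  by rewrite mxE; case: cid.
exists L; split=> //; split; [split|].
- move=> a X Y; apply/matrixP => i j; apply: (ccvg_unique (LP _ i j)); rewrite !mxE.
  rewrite (_ : (fun k => _) = (fun k => a * S k X i j + S k Y i j)); last first.
    by apply/funext => k; rewrite (cS k).1.1 !mxE.
  by apply: ccvgD (LP _ _ _); apply: ccvgM (ccvg_cst _) (LP _ _ _).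
- move=> r X pX; have [_ H] := posblkP (fun i j => L (X i j)); apply: H => v.
  apply: (@ccvg_ge0 (fun k => \sum_(p : 'I_r * 'I_m) \sum_(q : 'I_r * 'I_m)
     (v p)^* * S k (X p.1 q.1) p.2 q.2 * v q)).
    move=> k; have [H _] := posblkP (fun i j => S k (X i j)).
    by apply: (H ((cS k).1.2 _ _ pX)).
  apply: ccvg_sum => p; apply: ccvg_sum => q.
  by apply: ccvgM (ccvg_cst _); apply: ccvgM (ccvg_cst _) _.
- move=> X; apply: (@ccvg_unique (fun k => \tr (S k X))); first exact: ccvg_sum.
  under eq_fun => k do rewrite (cS k).2; exact: ccvg_cst.
Qed.

Section Peripheral.
Variables (d : nat) (T : 'M[C]_d -> 'M[C]_d).
Hypothesis cT : cptp T.
Let P : set 'M[C]_d := peripheral (T : linmap R d d).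

Lemma iter_eigen (lam : C) Y n : T Y = lam *: Y -> iter n T Y = lam ^+ n *: Y.
Proof.
move=> TY; elim: n => [|n IH]; first by rewrite scale1r.
by rewrite iterS IH (mxlinZ cT.1.1) TY scalerA exprSr.
Qed.

Lemma eigen_iter_cancel (lam : C) Y (A : 'M[C]_d -> 'M[C]_d) B t :
  `|lam| = 1 -> T Y = lam *: Y -> mxlinear A ->
  (forall s X i j, ccvg (fun k => iter (k - s) T X i j) (B s X i j)) ->
  (forall X i j, ccvg (fun m => B (m + t)%N X i j) (A X i j)) ->
  A (iter t T Y) = Y.
Proof.
move=> l1 TY lA HB HA.
have ll : lam * lam^* = 1 by rewrite -normCK l1 expr1n.
have [mu Hmu] : exists mu, ccvg (fun n => lam ^+ n) mu.
  by apply: (ccvg_bounded (M := 1)) => n; rewrite normrX l1 expr1n.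
have mm : mu * mu^* = 1.
  apply: ccvg_unique (ccvgM Hmu (ccvg_conj Hmu)) _.
  under eq_fun => n do rewrite -normCK normrX l1 !expr1n.
  exact: ccvg_cst.
have Hmuc : ccvg (fun m => lam^* ^+ m) mu^*.
  rewrite (_ : (fun m => _) = (fun m => (lam ^+ m)^*)); first exact: ccvg_conj.
  by apply/funext => m; rewrite rmorphXn.
have BE s i j : B s Y i j = mu * (lam^* ^+ s * Y i j).
  apply: ccvg_unique (HB s Y i j) _.
  apply: ccvg_near (ccvgM Hmu (ccvg_cst _)).
  (* The subtraction is truncated, so lam^(n-s) = lam^n (conj lam)^s only for n >= s; these n form a
     set of [F]. *)
  apply: ooF; exists s => // n /= sn.
  rewrite (iter_eigen _ TY) mxE mulrA; congr (_ * _).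
  by rewrite -{2}(subnK sn) exprD -mulrA -exprMn ll expr1n mulr1.
have AE i j : A Y i j = lam^* ^+ t * Y i j.
  apply: ccvg_unique (HA Y i j) _.
  under eq_fun => m do rewrite BE exprD -!mulrA.
  rewrite -[X in ccvg _ X]mul1r -mm -mulrA.
  by apply: ccvgM (ccvg_cst _) _; apply: ccvgM Hmuc (ccvg_cst _).
rewrite (iter_eigen _ TY) (mxlinZ lA); apply/matrixP => i j.
by rewrite mxE AE mulrA -exprMn ll expr1n mul1r.
Qed.

Lemma decay_ccvg (B : nat -> 'M[C]_d -> 'M[C]_d) s Z :
  (forall s X i j, ccvg (fun k => iter (k - s) T X i j) (B s X i j)) ->
  (fun n => rnorm (iter n T Z)) @ \oo --> (0 : R) -> B s Z = 0.
Proof.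
move=> HB Z0; apply/matrixP => i j; rewrite mxE.
apply: ccvg_unique (HB s Z i j) _.
have sub_oo : (subn^~ s) @ \oo --> \oo.
  move=> A [N _ HN]; exists (N + s)%N => // n /= Nn; apply: HN => /=.
  by rewrite leq_subRL ?(leq_trans _ Nn) ?leq_addl // addnC.
have Z1 : (fun k => rnorm (iter (k - s) T Z)) @ F --> (0 : R).
  by move=> A /Z0 /sub_oo; apply: ooF.
have entry_le k : complex.Re `|iter (k - s) T Z i j| <= rnorm (iter (k - s) T Z).
  rewrite -lecR -normc_Re rnormE /mxnorm1 (bigD1 i) //= (bigD1 j) //=.
  rewrite -addrA lerDl addr_ge0 ?sumr_ge0 // => a _; exact: sumr_ge0.
split; apply/cvgr0Pnorm_le => e e0; move/cvgr0Pnorm_le/(_ _ e0): Z1;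
  apply: filterS => k /= h; have [h1 h2] := Re_Im_le_norm (iter (k - s) T Z i j).
  by apply: le_trans h1 _; apply: le_trans (entry_le k) _; apply: le_trans h; apply: ler_norm.
by apply: le_trans h2 _; apply: le_trans (entry_le k) _; apply: le_trans h; apply: ler_norm.
Qed.

End Peripheral.
End UltrafilterLimits.

(** * The projection onto the peripheral space and the reversal of powers *)

Section AsymptoticProjection.
Variable R : realType.
Local Notation C := R[i].
Variables (d : nat) (T : 'M[C]_d -> 'M[C]_d).
Hypothesis cT : cptp T.
Let P : set 'M[C]_d := peripheral (T : linmap R d d).

(* Along an ultrafilter, T^(n-m-t) tends to an inverse of T^t on the
   peripheral space when first n and then m tends to infinity: on an eigenvector
   with eigenvalue lam the limit is mu * conj mu * conj lam ^ t with mu = lim lam ^ n. *)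
Lemma asymptotic_projection : exists (A : nat -> 'M[C]_d -> 'M[C]_d),
  [/\ forall t, cptp (A t),
      forall X, P (A 0%N X),
      forall X, (fun n => rnorm (iter n T (X - A 0%N X))) @ \oo --> (0 : R) &
      forall t Y, P Y -> A t (iter t T Y) = Y].
Proof.
have [F [UF ooF]] := @ultraFilterLemma nat \oo _.
have HB' s := ccvg_cptp UF (fun k => cptp_iter (k - s) cT).
pose B s := projT1 (cid (HB' s)).
have cB s : cptp (B s) by rewrite /B; case: cid => ? [].
have HB s X i j : ccvg F (fun k => iter (k - s) T X i j) (B s X i j).
  by rewrite /B; case: cid => ? [].
have HA' t := ccvg_cptp UF (fun m => cB (m + t)%N).
pose A s := projT1 (cid (HA' s)).
have cA s : cptp (A s) by rewrite /A; case: cid => ? [].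
have HA t X i j : ccvg F (fun m => B (m + t)%N X i j) (A t X i j).
  by rewrite /A; case: cid => ? [].
have AP t Y : P Y -> A t (iter t T Y) = Y.
  move=> [n [c [l [Z [HZ ->]]]]].
  have lt := (cptp_iter t cT).1.1; have lA := (cA t).1.1.
  rewrite (mxlin_sum lt) (mxlin_sum lA); apply: eq_bigr => i _.
  rewrite (mxlinZ lt) (mxlinZ lA); congr (_ *: _).
  exact: (eigen_iter_cancel UF ooF cT (HZ i).1 (HZ i).2 lA HB (HA t)).
(* [A 0] kills what decays and fixes what is peripheral, so it returns the peripheral part of any
   such splitting of X. *)
have A0 X Y : P Y -> (fun n => rnorm (iter n T (X - Y))) @ \oo --> (0 : R) -> A 0%N X = Y.
  move=> PY H.
  have BZ s : B s (X - Y) = 0 := decay_ccvg UF ooF s HB H.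
  have lA := (cA 0%N).1.1.
  have AZ : A 0%N (X - Y) = 0.
    apply/matrixP => i j; rewrite mxE; apply: (ccvg_unique UF (HA 0%N _ i j)).
    under eq_fun => m do rewrite BZ mxE; exact: ccvg_cst.
  have -> : X = (X - Y) + Y by rewrite subrK.
  by rewrite (mxlinD lA) AZ add0r; apply: (AP 0%N Y PY).
exists A; split=> // X; have [Y PY H] := peripheral_decomposition cT X;
  by rewrite (A0 X Y PY H).
Qed.

End AsymptoticProjection.

(** * Flattened tensor indices, entanglement fidelity, completion to a channel *)

Section Channels.
Variable R : realType.
Local Notation C := R[i].

Lemma trmxCE n m (A : 'M[C]_(n, m)) i j : (A ^t*) i j = (A j i)^*.
Proof. by rewrite !mxE. Qed.

Lemma psdmxP n (A : 'M[C]_n) : psdmx A <-> posker (fun i j => A i j).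
Proof.
split=> [[_ H]|H]; first by apply/psd_posker.
split; last by apply/psd_posker.
by apply/matrixP => i j; rewrite !mxE (posker_conj H j i).
Qed.

Lemma amplE k n m (T : linmap R n m) (X : 'M[C]_(k * n)) i j c e :
  ampl T X (mxtens_index (i, c)) (mxtens_index (j, e)) =
  T (\matrix_(a, b) X (mxtens_index (i, a)) (mxtens_index (j, b))) c e.
Proof.
rewrite /ampl summxE (bigD1 i) //= [X in _ + X]big1 ?addr0 => [|i' ne].
  rewrite summxE (bigD1 j) //= [X in _ + X]big1 ?addr0 => [|j' ne].
    by rewrite tensmxE mxE !eqxx mul1r.
  by rewrite tensmxE mxE [j == _]eq_sym (negbTE ne) andbF mul0r.
rewrite summxE big1 // => j' _.
by rewrite tensmxE mxE [i == _]eq_sym (negbTE ne) mul0r.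
Qed.

Lemma is_channelP n m (T : linmap R n m) : is_channel T <-> cptp T.
Proof.
split=> [[lT pT tT]|[[lT pT] tT]]; split=> //; [split=> //|] => k X pX.
  pose Xm : 'M[C]_(k * n) := \matrix_(p, q)
    X (mxtens_unindex p).1 (mxtens_unindex q).1 (mxtens_unindex p).2 (mxtens_unindex q).2.
  have XmE i j : \matrix_(a, b) Xm (mxtens_index (i, a)) (mxtens_index (j, b)) = X i j.
    by apply/matrixP => a b; rewrite !mxE !mxtens_indexK.
  have pXm : psdmx Xm.
    apply/psdmxP; have [H _] := posblkP X.
    have := posker_comp (@mxtens_unindex k n) (H pX).
    by congr (posker _); apply/funext => p; apply/funext => q; rewrite mxE.
  have /psdmxP/(posker_comp (@mxtens_index k m)) := pT _ _ pXm.
  move=> H; have [_ H'] := posblkP (fun i j => T (X i j)); apply: H'.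
  move: H; congr (posker _); apply/funext => -[i c]; apply/funext => -[j e].
  by rewrite amplE XmE.
have /psdmxP/(posker_comp (@mxtens_index k n)) pX' := pX.
have [_ H] := posblkP (fun i j : 'I_k =>
  \matrix_(a, b) X (mxtens_index (i, a)) (mxtens_index (j, b))).
have {}/H/pT : posker (fun p q : 'I_k * 'I_n =>
    (\matrix_(a, b) X (mxtens_index (p.1, a)) (mxtens_index (q.1, b))) p.2 q.2).
  by move: pX'; congr (posker _); apply/funext => -[i a]; apply/funext => -[j b]; rewrite mxE.
have [H1 _] := posblkP (fun i j : 'I_k =>
  T (\matrix_(a, b) X (mxtens_index (i, a)) (mxtens_index (j, b)))).
move/H1/(posker_comp (@mxtens_unindex k m)) => H2; apply/psdmxP.
move: H2; congr (posker _); apply/funext => p; apply/funext => q.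
by rewrite -[in RHS](mxtens_unindexK p) -[in RHS](mxtens_unindexK q);
  case: (mxtens_unindex p) => ? ?; case: (mxtens_unindex q) => ? ?; rewrite amplE.
Qed.

Lemma maxent_index D (i a : 'I_D) :
  maxent R D (mxtens_index (i, a)) 0 = ((Num.sqrt (D%:R : R))%:C^-1 * (i == a)%:R)%C.
Proof.
rewrite mxE mxtens_indexK /= -val_eqE /=.
by case: eqP => _; rewrite ?mulr1 ?mulr0.
Qed.

(** One factor 1/D comes from the input state and one from the vector it is tested against. *)
Lemma maxent_fidelity D (T : linmap R D D) : mxlinear T ->
  ((maxent R D) ^t* *m ampl T (maxent R D *m (maxent R D) ^t*) *m maxent R D) 0 0 =
  D%:R^-1 ^+ 2 * unnorm_fidelity T.
Proof.
move=> lT; set w := ((Num.sqrt (D%:R : R))%:C^-1)%C.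
have ww : w^* * w = D%:R^-1.
  have -> : w^* = w.
    apply/CrealP; rewrite rpredV; apply/complex_realP; by exists (Num.sqrt D%:R).
  by rewrite -invfM -realCM -expr2 sqr_sqrtr ?ler0n // realCn.
have blk i j : \matrix_(a, b) (maxent R D *m (maxent R D) ^t*)
    (mxtens_index (i, a)) (mxtens_index (j, b)) = D%:R^-1 *: delta_mx i j.
  apply/matrixP => a b; rewrite [LHS]mxE [RHS]mxE mxE big_ord1 trmxCE !maxent_index -/w.
  rewrite rmorphM /= conjC_nat mxE -mulnb natrM -ww [a == i]eq_sym [b == j]eq_sym.
  by rewrite mulrACA [w * _]mulrC.
rewrite mxE.
transitivity (\sum_(q : 'I_D * 'I_D) \sum_(p : 'I_D * 'I_D)
   (w^* * (p.1 == p.2)%:R) * (D%:R^-1 * T (delta_mx p.1 q.1) p.2 q.2) * (w * (q.1 == q.2)%:R)).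
  rewrite (reindex (@mxtens_index D D)) /=; last first.
    by exists (@mxtens_unindex D D) => x _; rewrite (mxtens_indexK, mxtens_unindexK).
  apply: eq_bigr => -[j b] _; rewrite mxE mulr_suml.
  rewrite (reindex (@mxtens_index D D)) /=; last first.
    by exists (@mxtens_unindex D D) => x _; rewrite (mxtens_indexK, mxtens_unindexK).
  apply: eq_bigr => -[i a] _.
  rewrite amplE blk (mxlinZ lT) !maxent_index -/w trmxCE maxent_index -/w.
  by rewrite rmorphM /= conjC_nat; congr (_ * _ * _); rewrite mxE.
transitivity (\sum_j \sum_i D%:R^-1 ^+ 2 * T (delta_mx i j) i j).
  rewrite -(pair_bigA _ (fun j b => \sum_(p : 'I_D * 'I_D)
   (w^* * (p.1 == p.2)%:R) * (D%:R^-1 * T (delta_mx p.1 j) p.2 b) * (w * (j == b)%:R))) /=.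
  apply: eq_bigr => j _; rewrite (bigD1 j) //= [X in _ + X]big1 ?addr0; last first.
    move=> b /negbTE bj; rewrite big1 // => p _.
    by rewrite [j == b]eq_sym bj !mulr0.
  rewrite -(pair_bigA _ (fun i a =>
   (w^* * (i == a)%:R) * (D%:R^-1 * T (delta_mx i j) a j) * (w * (j == j)%:R))) /=.
  apply: eq_bigr => i _; rewrite (bigD1 i) //= [X in _ + X]big1 ?addr0; last first.
    by move=> a /negbTE ai; rewrite [i == a]eq_sym ai !(mulr0, mul0r).
  by rewrite !eqxx !mulr1 mulrC mulrA [w * _]mulrC ww mulrA -expr2.
rewrite exchange_big /= /unnorm_fidelity mulr_sumr; apply: eq_bigr => i _.
by rewrite mulr_sumr.
Qed.

(* The defect projector 1 - sum A_i^* A_i is sent to a fixed pure state. *)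
Lemma kraus_complete D n (I : finType) (A : I -> 'M[C]_(D, n)) :
  let Q := \sum_i (A i) ^t* *m A i in
  (0 < D)%N -> Q *m Q = Q ->
  exists S, cptp S /\ exists2 S', cpmap S' &
    forall X, S X = \sum_i A i *m X *m (A i) ^t* + S' X.
Proof.
move=> Q D0 QQ; pose i0 := Ordinal D0; pose N := 1%:M - Q.
have QJ : Q ^t* = Q.
  rewrite /Q linear_sum /= raddf_sum /=; apply: eq_bigr => i _.
  by rewrite trmx_mul map_mxM trmxCK.
have NJ : N ^t* = N by rewrite /N linearB /= map_mxB QJ trmx1 map_mx1.
have NN : N *m N = N by rewrite /N mulmxBl mul1mx mulmxBr mulmx1 QQ subrr subr0.
(* As [Q] is idempotent, [N] is a projector and its own square root: these Kraus operators
   contribute N e_jj N, with sum [N]. *)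
pose S' X := \sum_(j < n) ((delta_mx i0 j *m N) *m X *m (delta_mx i0 j *m N) ^t*).
have cS' : cpmap S' by apply: cp_sum => j; apply: cp_conj.
have cS1 : cpmap (fun X => \sum_i A i *m X *m (A i) ^t*).
  by apply: cp_sum => j; apply: cp_conj.
exists (fun X => \sum_i A i *m X *m (A i) ^t* + S' X); split; last by exists S'.
split; first exact: cp_add.
move=> X; rewrite mxtraceD linear_sum /= /S' linear_sum /=.
have -> : \sum_i \tr (A i *m X *m (A i) ^t*) = \tr (X *m Q).
  rewrite /Q mulmx_sumr linear_sum /=; apply: eq_bigr => i _.
  by rewrite [LHS]mxtrace_mulC [in LHS]mulmxA [LHS]mxtrace_mulC.
have -> : \sum_(j < n) \tr ((delta_mx i0 j *m N) *m X *m (delta_mx i0 j *m N) ^t*) = \tr (X *m N).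
  have dd : \sum_(j < n) (delta_mx i0 j : 'M[C]_(D, n)) ^t* *m (delta_mx i0 j : 'M[C]_(D, n)) = 1%:M.
    rewrite mx1_sum_delta; apply: eq_bigr => j _.
    have -> : (delta_mx i0 j : 'M[C]_(D, n)) ^t* = delta_mx j i0.
      by rewrite trmx_delta map_delta_mx.
    by rewrite mul_delta_mx.
  transitivity (\tr (N *m X *m N *m 1%:M)).
    rewrite -dd mulmx_sumr linear_sum /=; apply: eq_bigr => j _.
    by rewrite trmx_mul map_mxM NJ -!mulmxA [LHS]mxtrace_mulC -!mulmxA.
  by rewrite mulmx1 -mulmxA mxtrace_mulC -mulmxA NN.
by rewrite -linearD /= -mulmxDr /N addrC subrK mulmx1.
Qed.

End Channels.

(** * The block decomposition and bounds for codes followed by the projection *)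

Section BlockStructure.
Variable R : realType.
Local Notation C := R[i].
Variables (d K : nat) (dk mk : 'I_K -> nat).
Variables (V : forall k : 'I_K, 'M[C]_(d, dk k * mk k)) (omega : forall k : 'I_K, 'M[C]_(mk k)).
Hypothesis VI : forall k, (V k) ^t* *m V k = 1%:M.
Hypothesis VO : forall k l, k != l -> (V k) ^t* *m V l = 0.
Hypothesis dens : forall k, density (omega k).

(** [V k] on the vectors x tensor e_s: partial traces and tensoring with [omega k] become sums over
    [s]. *)
Definition slice k (s : 'I_(mk k)) : 'M[C]_(d, dk k) :=
  \matrix_(i, a) V k i (mxtens_index (a, s)).
Local Notation W := slice.

Lemma slice_mul_entry k l s s' a b :
  ((W s) ^t* *m W s') a b = ((V k) ^t* *m V l) (mxtens_index (a, s)) (mxtens_index (b, s')).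
Proof. by rewrite !mxE; apply: eq_bigr => i _; rewrite !mxE. Qed.

Lemma slice_ortho k (s s' : 'I_(mk k)) : (W s) ^t* *m W s' = (s == s')%:R%:M.
Proof.
apply/matrixP => a b; rewrite slice_mul_entry VI !mxE (can_eq (@mxtens_indexK _ _)).
by rewrite xpair_eqE andbC; case: (s == s'); case: (a == b).
Qed.

Lemma slice_ortho_neq k l (s : 'I_(mk k)) (s' : 'I_(mk l)) :
  k != l -> (W s) ^t* *m W s' = 0.
Proof. by move=> kl; apply/matrixP => a b; rewrite slice_mul_entry VO // !mxE. Qed.

Definition block_in k (X : 'M[C]_(dk k)) : 'M[C]_d :=
  \sum_s \sum_s' omega k s s' *: (W s *m X *m (W s') ^t*).
Local Notation G := block_in.

Lemma block_inE k (X : 'M[C]_(dk k)) : V k *m (X *t omega k) *m (V k) ^t* = G X.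
Proof.
apply/matrixP => i j; rewrite summxE mxE.
rewrite (reindex (@mxtens_index _ _)) /=; last first.
  by exists (@mxtens_unindex _ _) => x _; rewrite (mxtens_indexK, mxtens_unindexK).
transitivity (\sum_(q : 'I_(dk k) * 'I_(mk k)) \sum_(p : 'I_(dk k) * 'I_(mk k))
   V k i (mxtens_index (p.1, p.2)) * (X p.1 q.1 * omega k p.2 q.2) * (V k j (mxtens_index (q.1, q.2)))^*).
  apply: eq_bigr => -[b s'] _; rewrite trmxCE mxE mulr_suml.
  rewrite (reindex (@mxtens_index _ _)) /=; last first.
    by exists (@mxtens_unindex _ _) => x _; rewrite (mxtens_indexK, mxtens_unindexK).
  by apply: eq_bigr => -[a s] _; rewrite tensmxE.
rewrite exchange_big /=.
rewrite -(pair_bigA _ (fun a s => \sum_(q : 'I_(dk k) * 'I_(mk k))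
   V k i (mxtens_index (a, s)) * (X a q.1 * omega k s q.2) * (V k j (mxtens_index (q.1, q.2)))^*)) /=.
rewrite exchange_big /=; apply: eq_bigr => s _.
rewrite summxE.
under eq_bigr => a _.
  rewrite -(pair_bigA _ (fun b s' => V k i (mxtens_index (a, s)) *
    (X a b * omega k s s') * (V k j (mxtens_index (b, s')))^*)) /= exchange_big /=.
  over.
rewrite exchange_big /=; apply: eq_bigr => s' _.
rewrite [RHS]mxE [X in _ = _ * X]mxE mulr_sumr exchange_big /=; apply: eq_bigr => b _.
rewrite trmxCE ![W _ _ _]mxE [X in _ = _ * (X * _)]mxE mulr_suml mulr_sumr.
by apply: eq_bigr => a _; rewrite mxE; ring.
Qed.

Lemma block_in_cptp k : cptp (@G k).
Proof.
have [[oJ oP] o1] := dens k; have [B BE] := psd_factor oJ oP.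
split.
  (* One Kraus operator for each column of the factor [B] of [omega k]. *)
  apply: (@cp_ext _ _ _ (fun X => \sum_r (\sum_s B s r *: W s) *m X *m (\sum_s B s r *: W s) ^t*)).
    move=> X; rewrite /block_in.
    under [RHS]eq_bigr => s _ do under eq_bigr => s' _ do
      rewrite BE mxE scaler_suml.
    under [RHS]eq_bigr => s _ do rewrite exchange_big /=.
    rewrite [RHS]exchange_big /=; apply: eq_bigr => r _.
    rewrite !mulmx_suml; apply: eq_bigr => s _.
    rewrite raddf_sum /= map_mx_sum mulmx_sumr; apply: eq_bigr => s' _.
    by rewrite trmxCE linearZ /= map_mxZ -!scalemxAl -scalemxAr scalerA mulrC.
  by apply: cp_sum => r; apply: cp_conj.
move=> X; rewrite /block_in linear_sum /= -[RHS]mul1r -o1 [X in _ = X * _]/mxtrace mulr_suml.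
apply: eq_bigr => s _; rewrite linear_sum /= (bigD1 s) //= [X in _ + X]big1 ?addr0.
  by rewrite mxtraceZ -mulmxA mxtrace_mulC -mulmxA slice_ortho eqxx mulmx1.
move=> s' ne; rewrite mxtraceZ -mulmxA mxtrace_mulC -mulmxA slice_ortho (negbTE ne).
by rewrite mul_mx_scalar scale0r linear0 mulr0.
Qed.

Lemma slice_block_in k (s : 'I_(mk k)) X : (W s) ^t* *m G X *m W s = omega k s s *: X.
Proof.
rewrite /block_in mulmx_sumr mulmx_suml (bigD1 s) //= [X in _ + X]big1 ?addr0; last first.
  move=> s1 ne; rewrite mulmx_sumr mulmx_suml big1 // => s2 _.
  rewrite -scalemxAr -scalemxAl !mulmxA slice_ortho eq_sym (negbTE ne).
  by rewrite mul_scalar_mx scale0r !mul0mx scaler0.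
rewrite mulmx_sumr mulmx_suml (bigD1 s) //= [X in _ + X]big1 ?addr0; last first.
  move=> s1 ne; rewrite -scalemxAr -scalemxAl -!mulmxA slice_ortho (negbTE ne).
  by rewrite mul_mx_scalar scale0r !mulmx0 scaler0.
by rewrite -scalemxAr -scalemxAl !mulmxA slice_ortho eqxx mul1mx -mulmxA slice_ortho eqxx mulmx1.
Qed.

Lemma slice_block_in_neq k l (s : 'I_(mk k)) (X : 'M[C]_(dk l)) : k != l -> (W s) ^t* *m G X = 0.
Proof.
move=> kl; rewrite /block_in mulmx_sumr big1 // => s1 _; rewrite mulmx_sumr big1 // => s2 _.
by rewrite -scalemxAr !mulmxA slice_ortho_neq // !mul0mx scaler0.
Qed.

(** The compression to block k followed by the partial trace over H_{k,2}. *)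
Definition block_out k (X : 'M[C]_d) : 'M[C]_(dk k) := \sum_(s < mk k) (W s) ^t* *m X *m W s.
Local Notation F := block_out.

Lemma block_out_cp k : cpmap (F k).
Proof.
apply: cp_sum => s; have := cp_conj ((W s) ^t*); apply: cp_ext => X.
by rewrite trmxCK.
Qed.

Lemma block_outK k : cancel (@G k) (F k).
Proof.
move=> X; rewrite /block_out; under eq_bigr => s _ do rewrite slice_block_in.
by rewrite -scaler_suml -[\sum_i _]/(\tr (omega k)) (dens k).2 scale1r.
Qed.

Lemma block_out_neq k l (X : 'M[C]_(dk l)) : k != l -> F k (G X) = 0.
Proof.
move=> kl; rewrite /block_out big1 // => s _.
by rewrite slice_block_in_neq // mul0mx.
Qed.

Lemma block_out_sum (Xs : forall k, 'M[C]_(dk k)) k : F k (\sum_l G (Xs l)) = Xs k.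
Proof.
rewrite (mxlin_sum (block_out_cp k).1) (bigD1 k) //= block_outK big1 ?addr0 // => l lk.
by rewrite block_out_neq // eq_sym.
Qed.

Section Projection.
Variable P : 'M[C]_d -> 'M[C]_d.
Hypothesis cP : cptp P.
Hypothesis rangeP : forall X, exists Xs : forall k, 'M[C]_(dk k), P X = \sum_k G (Xs k).

Lemma projE X : P X = \sum_k G (F k (P X)).
Proof.
have [Xs ->] := rangeP X; by apply: eq_bigr => k _; rewrite block_out_sum.
Qed.

(** A single [block_out] loses the trace outside its block, but a matrix in the range of [P] lives
    on the blocks together. *)
Lemma sum_trace_block_out X : \sum_k \tr (F k (P X)) = \tr X.
Proof.
rewrite -[RHS](cP.2) [in RHS]projE linear_sum /=.
by apply: eq_bigr => k _; rewrite (block_in_cptp k).2.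
Qed.

Section Code.
Variables (D : nat) (E : 'M[C]_D -> 'M[C]_d) (S : 'M[C]_d -> 'M[C]_D).
Hypotheses (cE : cptp E) (cS : cptp S).

Lemma block_cp k : cpmap (F k \o P \o E).
Proof. by apply: cp_comp cE.1; apply: cp_comp cP.1; apply: block_out_cp. Qed.

Lemma block_trace_ge0 k i : 0 <= \tr (F k (P (E (delta_mx i i)))).
Proof.
apply: posker_trace_ge0; apply: (cp_posker (block_cp k)); exact: posker_delta.
Qed.

(** In block k every codeword has trace at most 1, so the block contributes at most d_k. *)
Lemma classical_proj_le :
  `|\sum_i S (P (E (delta_mx i i))) i i| <= (\sum_k dk k)%:R.
Proof.
have -> : \sum_i S (P (E (delta_mx i i))) i i =
    \sum_k \sum_i S (G (F k (P (E (delta_mx i i))))) i i.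
  rewrite exchange_big /=; apply: eq_bigr => i _.
  by rewrite [in LHS]projE (mxlin_sum cS.1.1) summxE.
apply: le_trans (ler_norm_sum _ _ _) _; rewrite natr_sum; apply: ler_sum => k _.
apply: (classical_bound (G := S \o @G k)) => [|i|i].
- exact: cptp_comp (block_in_cptp k).
- apply: (cp_posker (block_cp k)); exact: posker_delta.
have := sum_trace_block_out (E (delta_mx i i)).
rewrite cE.2 mxtrace_delta eqxx mulr1n => <-.
by rewrite (bigD1 k) //= lerDl sumr_ge0 // => l _; apply: block_trace_ge0.
Qed.

(** Block k contributes at most d_k times the trace it receives. The traces add up to D over all
    blocks, hence a maximum in place of a sum. *)
Lemma quantum_proj_le :
  `|unnorm_fidelity (S \o P \o E)| <= (\max_k dk k)%:R * D%:R.
Proof.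
have -> : unnorm_fidelity (S \o P \o E) =
    \sum_k unnorm_fidelity ((S \o @G k) \o (F k \o P \o E)).
  rewrite /unnorm_fidelity [RHS]exchange_big /=; apply: eq_bigr => i _.
  rewrite [RHS]exchange_big /=; apply: eq_bigr => j _.
  by rewrite [in LHS]projE (mxlin_sum cS.1.1) summxE.
apply: le_trans (ler_norm_sum _ _ _) _.
apply: le_trans (_ : \sum_k (\max_k dk k)%:R *
   \sum_i \tr (F k (P (E (delta_mx i i)))) <= _).
  apply: ler_sum => k _.
  apply: le_trans (quantum_bound (cptp_comp cS (block_in_cptp k)) (block_cp k)) _.
  apply: ler_wpM2r; first by apply: sumr_ge0 => i _; apply: block_trace_ge0.
  by rewrite ler_nat leq_bigmax.
rewrite -mulr_sumr exchange_big /= ler_wpM2l //.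
under eq_bigr => i _ do rewrite sum_trace_block_out cE.2 mxtrace_delta eqxx.
by rewrite sumr_const card_ord.
Qed.

End Code.
End Projection.
End BlockStructure.

(** * Codes that are perfect on as many levels as fit *)

Section ExactCodes.
Variable R : realType.
Local Notation C := R[i].
Variables (d K : nat) (dk mk : 'I_K -> nat).
Variables (V : forall k : 'I_K, 'M[C]_(d, dk k * mk k)) (omega : forall k : 'I_K, 'M[C]_(mk k)).
Hypothesis VI : forall k, (V k) ^t* *m V k = 1%:M.
Hypothesis VO : forall k l, k != l -> (V k) ^t* *m V l = 0.
Hypothesis dens : forall k, density (omega k).
Local Notation W := (slice V).
Local Notation G := (block_in V omega).
(** [Z] will be [A t] after the t-th power of [T]; the decoder for that power is then [S] after
    [A t]. *)
Variable Z : 'M[C]_d -> 'M[C]_d.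
Hypothesis ZG : forall k X, Z (G (k:=k) X) = G X.

Lemma trmxC_delta n m (i : 'I_n) (j : 'I_m) :
  (delta_mx i j : 'M[C]_(n, m)) ^t* = delta_mx j i.
Proof. by rewrite trmx_delta map_delta_mx. Qed.

Lemma sum_ltn_ord D r : \sum_(i < D) ((i < r)%N%:R : C) = (minn D r)%:R.
Proof.
rewrite -natr_sum; congr (_%:R).
rewrite -[RHS](card_ord (minn D r)) -sum1_card (big_ord_widen _ (fun=> 1%N) (geq_minl D r)) /=.
by rewrite [RHS]big_mkcond; apply: eq_bigr => i _; rewrite leq_min ltn_ord; case: (i < r)%N.
Qed.

Lemma ler_sum_inj (I J : finType) (h : I -> J) (f : J -> C) :
  injective h -> (forall j, 0 <= f j) -> \sum_i f (h i) <= \sum_j f j.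
Proof.
move=> hI f0; have := @big_imset _ 0 +%R _ _ h predT f (in2W hI).
rewrite /= => <-; rewrite [leRHS](bigID (mem (h @: predT)%SET)) /= lerDl; exact: sumr_ge0.
Qed.

(** Encoder and decoder act through the partial identity of rank r. It transmits e_ij for i, j < r,
    which gives r^2; the terms that complete them to channels are completely positive and cannot
    lower the fidelity. *)
Lemma quantum_exact_code D k : (0 < D)%N -> (0 < dk k)%N ->
  exists (E : 'M[C]_D -> 'M[C]_d) (S : 'M[C]_d -> 'M[C]_D), [/\ cptp E, cptp S &
    ((minn D (dk k))%:R : C) ^+ 2 <= unnorm_fidelity (S \o Z \o E)].
Proof.
move=> D0 dk0; set r := minn D (dk k).
have rD : (r <= D)%N by apply: geq_minl.
have rk : (r <= dk k)%N by apply: geq_minr.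
pose p m n : 'M[C]_(m, n) := pid_mx r.
have pJ m n : (p m n) ^t* = p n m.
  by apply/matrixP => i j; rewrite !mxE conjC_nat eq_sym; case: eqP => //= ->.
have p1p2 : p D (dk k) *m p (dk k) D = p D D by apply: pid_mx_id.
have p2p1 : p (dk k) D *m p D (dk k) = p (dk k) (dk k) by apply: pid_mx_id.
have pDD : p D D *m p D D = p D D by apply: pid_mx_id.
have pkk : p (dk k) (dk k) *m p (dk k) (dk k) = p (dk k) (dk k) by apply: pid_mx_id.
have [E [cE [E' cE' EE]]] := @kraus_complete R (dk k) D 'I_1 (fun _ => p (dk k) D) dk0
  (ltac:(by rewrite big_ord1 pJ p1p2 pDD)).
have QQ : let Q := \sum_s (p D (dk k) *m (W s) ^t*) ^t* *m (p D (dk k) *m (W (k:=k) s) ^t*) in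
    Q *m Q = Q.
  have QE s : (p D (dk k) *m (W s) ^t*) ^t* *m (p D (dk k) *m (W s) ^t*) =
      W (k:=k) s *m p (dk k) (dk k) *m (W s) ^t*.
    by rewrite trmx_mul map_mxM trmxCK pJ -p2p1 !mulmxA.
  rewrite /=; under eq_bigr => s _ do rewrite QE.
  rewrite mulmx_suml; apply: eq_bigr => s _; rewrite mulmx_sumr (bigD1 s) //=.
  rewrite [X in _ + X]big1 ?addr0 => [|s' ne].
    rewrite -!mulmxA (mulmxA _ (W s)) (slice_ortho VI) eqxx mul1mx.
    by rewrite [p _ _ *m (p _ _ *m _)]mulmxA pkk.
  rewrite -!mulmxA (mulmxA _ (W s')) (slice_ortho VI) eq_sym (negbTE ne).
  by rewrite mul_scalar_mx scale0r !mulmx0.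
have [S [cS [S' cS' SE]]] := kraus_complete D0 QQ.
exists (fun X => G (E X)), S; split=> //.
  exact: (cptp_comp (block_in_cptp VI dens k) cE).
have SG X : S (G (k:=k) X) = p D (dk k) *m X *m (p D (dk k)) ^t* + S' (G X).
  rewrite SE; congr (_ + _).
  transitivity (\sum_s p D (dk k) *m ((W s) ^t* *m G X *m W (k:=k) s) *m (p D (dk k)) ^t*).
    by apply: eq_bigr => s _; rewrite trmx_mul map_mxM trmxCK !mulmxA.
  by rewrite -mulmx_suml -mulmx_sumr -[\sum_s _]/(block_out V k (G X)) (block_outK VI dens).
pose rest X := p D (dk k) *m E' X *m (p D (dk k)) ^t* + S' (G (E X)).
have crest : cpmap rest.
  apply: cp_add; first exact: (cp_comp (cp_conj _) cE').
  by apply: (cp_comp cS'); apply: cp_comp cE.1; apply: (block_in_cptp VI dens k).1.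
have SZE X : (S \o Z \o (fun X => G (E X))) X = p D D *m X *m p D D + rest X.
  rewrite /= ZG SG EE big_ord1 mulmxDr mulmxDl -addrA; congr (_ + _).
    by rewrite !pJ !mulmxA p1p2 -mulmxA p1p2.
  by rewrite /rest EE big_ord1.
have fidE : unnorm_fidelity (S \o Z \o (fun X => G (E X))) = r%:R ^+ 2 + unnorm_fidelity rest.
  rewrite /unnorm_fidelity.
  under eq_bigr => i _ do under eq_bigr => j _ do rewrite SZE mxE.
  under eq_bigr => i _ do rewrite big_split.
  rewrite big_split /=; congr (_ + _).
  have pidE (i j : 'I_D) : (p D D *m delta_mx i j *m p D D) i j = (i < r)%:R * (j < r)%:R.
    rewrite -(mul_delta_mx (0 : 'I_1)) !mulmxA -mulmxA mxE big_ord1.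
    by rewrite -rowE -colE !mxE !eqxx.
  under eq_bigr => i _ do under eq_bigr => j _ do rewrite pidE.
  under eq_bigr => i _ do rewrite -mulr_sumr.
  rewrite -mulr_suml expr2.
  suff -> : \sum_(i < D) ((i < r)%:R : C) = r%:R by [].
  by rewrite sum_ltn_ord /r minnA minnn.
have : r%:R ^+ 2 <= r%:R ^+ 2 + unnorm_fidelity rest by rewrite lerDl fidelity_ge0.
by rewrite -fidE.
Qed.

Lemma classical_exact_code D : (0 < D)%N -> (0 < \sum_k dk k)%N ->
  exists (E : 'M[C]_D -> 'M[C]_d) (S : 'M[C]_d -> 'M[C]_D), [/\ cptp E, cptp S &
    ((minn D (\sum_k dk k))%:R : C) <= \sum_i S (Z (E (delta_mx i i))) i i].
Proof.
move=> D0 s0; pose i0 := Ordinal D0.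
pose L := {k : 'I_K & 'I_(dk k)}.
have cardL : #|{: L}| = (\sum_k dk k)%N.
  rewrite card_tagged sumnE big_map big_enum /=.
  by apply: eq_bigr => k _; rewrite card_ord.
have [l0 _] : exists l : L, l \in {: L} by apply/card_gt0P; rewrite cardL.
(* Levels beyond the number of labels are all sent as [l0], and labels beyond D are all read as
   [i0]; on the remaining levels [psi] inverts [phi]. *)
pose phi (i : 'I_D) : L := nth l0 (enum {: L}) i.
pose psi (l : L) : 'I_D := insubd i0 (index l (enum {: L})).
have psiK (i : 'I_D) : (i < \sum_k dk k)%N -> psi (phi i) = i.
  move=> il; apply/val_inj; rewrite /psi /phi index_uniq ?enum_uniq //.
    by rewrite val_insubd ltn_ord.
  by rewrite -cardT cardL.
pose enc (i : 'I_D) (X : 'M[C]_D) : 'M[C]_d :=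
  G (delta_mx (tagged (phi i)) i *m X *m (delta_mx (tagged (phi i)) i) ^t*).
pose E X := \sum_i enc i X.
have cE : cptp E.
  split.
    apply: cp_sum => i.
    exact: (cp_comp (block_in_cptp VI dens (tag (phi i))).1 (cp_conj _)).
  move=> X; rewrite linear_sum /=; apply: eq_bigr => i _.
  rewrite (block_in_cptp VI dens _).2 trmxC_delta mxtrace_mulC mulmxA mul_delta_mx.
  rewrite -(mul_delta_mx (0 : 'I_1)) -mulmxA mxtrace_mulC /mxtrace big_ord1.
  by rewrite -rowE -colE !mxE.
(* The vectors V_k (e_a tensor e_s) are orthonormal. The decoder measures in them, forgets s and
   outputs the level of the label (k, a). *)
pose J := {k : 'I_K & ('I_(dk k) * 'I_(mk k))%type}.
pose w (j : J) : 'cV[C]_d := W (tagged j).2 *m delta_mx (tagged j).1 0.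
have ww (j j' : J) : (w j) ^t* *m w j' = (j == j')%:R%:M.
  case: j => k [a s]; case: j' => l [b s'].
  rewrite /w /= trmx_mul map_mxM trmxC_delta -mulmxA (mulmxA _ _ (delta_mx b 0)).
  have [e|ne] := eqVneq k l.
    subst l; rewrite (slice_ortho VI) eq_Tagged /= xpair_eqE.
    rewrite mul_scalar_mx -scalemxAr mul_delta_mx_cond; apply/matrixP => x y.
    by rewrite !ord1; case: (a == b); case: (s == s'); rewrite ?mulr1n ?mulr0n !mxE /= ?mulr1 ?mulr0.
  rewrite (slice_ortho_neq VO) // mul0mx mulmx0.
  have -> : (Tagged (fun k => ('I_(dk k) * 'I_(mk k))%type) (a, s) ==
     Tagged (fun k => ('I_(dk k) * 'I_(mk k))%type) (b, s') :> J) = false.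
    by apply/negP => /eqP/(congr1 tag) /= /eqP; rewrite (negbTE ne).
  by apply/matrixP => x y; rewrite !mxE mulr0n mul0rn.
pose A (j : J) : 'M[C]_(D, d) :=
  delta_mx (psi (Tagged (fun k => 'I_(dk k)) (tagged j).1)) 0 *m (w j) ^t*.
have wJ k (a : 'I_(dk k)) (s : 'I_(mk k)) :
    (w (Tagged (fun k => ('I_(dk k) * 'I_(mk k))%type) (a, s))) ^t* = delta_mx 0 a *m (W s) ^t*.
  by rewrite /w /= trmx_mul map_mxM trmxC_delta.
have AJ j : (A j) ^t* = w j *m
    delta_mx 0 (psi (Tagged (fun k => 'I_(dk k)) (tagged j).1)).
  by rewrite /A trmx_mul map_mxM trmxCK trmxC_delta.
have QQ : let Q := \sum_j (A j) ^t* *m A j in Q *m Q = Q.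
  have QE j : (A j) ^t* *m A j = w j *m (w j) ^t*.
    rewrite AJ /A mulmxA -[w j *m _ *m _]mulmxA.
    rewrite mul_delta_mx (_ : delta_mx 0 0 = 1%:M) ?mulmx1 //.
    by apply/matrixP => x y; rewrite !ord1 !mxE.
  rewrite /=; under eq_bigr => s _ do rewrite QE.
  rewrite mulmx_suml; apply: eq_bigr => s _; rewrite mulmx_sumr (bigD1 s) //=.
  rewrite [X in _ + X]big1 ?addr0 => [|s' ne].
    by rewrite mulmxA -[w s *m _ *m _]mulmxA ww eqxx mulmx1.
  rewrite mulmxA -[w s *m _ *m _]mulmxA ww eq_sym (negbTE ne).
  by rewrite mul_mx_scalar scale0r mul0mx.
have [S [cS [S' cS' SE]]] := kraus_complete D0 QQ.
exists E, S; split=> //.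
have Edelta i : E (delta_mx i i) = G (delta_mx (tagged (phi i)) (tagged (phi i))).
  rewrite /E (bigD1 i) //= big1 ?addr0 => [|i' ne].
    by rewrite /enc trmxC_delta !mul_delta_mx.
  rewrite /enc trmxC_delta mul_delta_mx_0 ?mul0mx //.
  exact: mxlin0 (block_in_cptp VI dens _).1.1.
have le (i : 'I_D) : (i < \sum_k dk k)%N -> 1 <= S (Z (E (delta_mx i i))) i i.
  move=> il; rewrite Edelta ZG SE mxE.
  have pG : posker (fun a b => (G (delta_mx (tagged (phi i)) (tagged (phi i)))) a b).
    apply: (cp_posker (block_in_cptp VI dens _).1); exact: posker_delta.
  have S'0 : 0 <= S' (G (delta_mx (tagged (phi i)) (tagged (phi i)))) i i.
    exact: posker_ge0 (cp_posker cS' pG) i.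
  apply: le_trans (_ : (\sum_j A j *m G (delta_mx (tagged (phi i)) (tagged (phi i))) *m
       (A j) ^t*) i i <= _); last by rewrite lerDl.
  rewrite summxE.
  have term0 j : 0 <= (A j *m G (delta_mx (tagged (phi i)) (tagged (phi i))) *m (A j) ^t*) i i.
    exact: posker_ge0 (cp_posker (cp_conj (A j)) pG) i.
  move: term0; have := psiK i il; case: (phi i) => k a /= psi_i term0.
  (* The outcomes (k, a, s) with s varying suffice: their probabilities are the diagonal entries of
     [omega k], with sum 1. *)
  apply: le_trans (_ : \sum_s (A (Tagged (fun k => ('I_(dk k) * 'I_(mk k))%type) (a, s)) *m
     G (delta_mx a a) *m (A (Tagged (fun k => ('I_(dk k) * 'I_(mk k))%type) (a, s))) ^t*) i i <= _).
    rewrite -(dens k).2 /mxtrace; apply: ler_sum => s _.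
    have -> : A (Tagged (fun k => ('I_(dk k) * 'I_(mk k))%type) (a, s)) *m
        G (delta_mx a a) *m (A (Tagged (fun k => ('I_(dk k) * 'I_(mk k))%type) (a, s))) ^t* =
        delta_mx i 0 *m (delta_mx (0 : 'I_1) a *m ((W s) ^t* *m G (delta_mx a a) *m W s) *m
          delta_mx a (0 : 'I_1)) *m delta_mx 0 i.
      by rewrite AJ {1}/A /= psi_i wJ /w /= !mulmxA.
    rewrite (slice_block_in _ VI) -scalemxAr -!scalemxAl !mul_delta_mx.
    by rewrite -scalemxAr -scalemxAl !mul_delta_mx !mxE !eqxx mulr1.
  apply: (@ler_sum_inj _ J (fun s => Tagged (fun k => ('I_(dk k) * 'I_(mk k))%type) (a, s))
    (fun j => (A j *m G (delta_mx a a) *m (A j) ^t*) i i)) => // s s' /eqP.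
  by rewrite eq_Tagged /= xpair_eqE eqxx => /eqP.
have ge0 i : 0 <= S (Z (E (delta_mx i i))) i i.
  rewrite Edelta ZG; apply: (posker_ge0 (cp_posker cS.1 _) i).
  by apply: (cp_posker (block_in_cptp VI dens _).1); exact: posker_delta.
rewrite -sum_ltn_ord; apply: ler_sum => i _.
by have [/le|_] := boolP (i < \sum_k dk k)%N.
Qed.

End ExactCodes.

(** * Transient error, integrality of code sizes, capacities *)

Section Capacities.
Variable R : realType.
Local Notation C := R[i].

Lemma ler_log2 (x y : R) : 0 < x -> x <= y -> log2 x <= log2 y.
Proof.
move=> x0 xy; rewrite /log2 ler_wpM2r ?invr_ge0 ?ln_ge0 ?ler1n //.
by rewrite ler_ln // posrE // (lt_le_trans x0).
Qed.

Lemma floor_natE (x : R) : 1 <= x ->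
  exists n, [/\ (0 < n)%N, Num.floor x = n%:Z & n%:R <= x].
Proof.
move=> x1; have f1 : (1 <= Num.floor x)%R by rewrite floor_ge_int.
have := floor_le x; case: (Num.floor x) f1 => // n n1 nx.
by exists n.
Qed.

(** An integer D > s / c is at least N + 1, where N is the integer part of s / c. Once eps t < c - s
    / (N + 1), such a D satisfies D (c - eps t) > s. The threshold for t is the same for all D. *)
Lemma eventually_size_le (s c : R) (eps : nat -> R) : 0 <= s -> 0 < c ->
  eps @ \oo --> (0 : R) ->
  \forall t \near \oo, forall D : nat, D%:R * c <= s + D%:R * eps t -> D%:R <= s / c.
Proof.
move=> s0 c0 eps0; set x := s / c.
have x0 : 0 <= x by rewrite divr_ge0 // ltW.
have /andP[Nx xN] := truncn_itv x0; set N := Num.truncn x in Nx xN.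
have N0 : 0 < N.+1%:R :> R by rewrite ltr0n.
have gap : 0 < c - s / N.+1%:R.
  by rewrite subr_gt0 ltr_pdivrMr // mulrC -ltr_pdivrMr.
move/cvgrPdist_lt/(_ _ gap): eps0; apply: filterS => t /= ht D HD.
rewrite leNgt; apply/negP => xD.
have ND : (N.+1 <= D)%N.
  by rewrite ltnNge; apply/negP => DN; move: xD; rewrite ltNge (le_trans _ Nx) // ler_nat.
have e_lt : eps t < c - s / N.+1%:R.
  by apply: le_lt_trans ht; rewrite sub0r normrN ler_norm.
have D0 : 0 < D%:R :> R by rewrite ltr0n (leq_trans _ ND).
have : D%:R * (s / N.+1%:R) < s.
  have := e_lt; rewrite -(ltr_pM2l D0) mulrBr ltrBrDr => /lt_le_trans/(_ HD).
  by rewrite addrC ltrD2r.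
apply/negP; rewrite -leNgt mulrCA ler_peMr // ler_pdivlMr // mul1r ler_nat //.
Qed.

Section Error.
Variables (d : nat) (T P : 'M[C]_d -> 'M[C]_d).
Hypotheses (cT : cptp T) (cP : cptp P).
Hypothesis decay : forall X, (fun n => rnorm (iter n T (X - P X))) @ \oo --> (0 : R).

(** The matrix units span M_d, so one sequence controls the error for all encoders, decoders and
    code sizes. *)
Definition transient_error (t : nat) : R :=
  \sum_(ab : 'I_d * 'I_d)
    rnorm (iter t T (delta_mx ab.1 ab.2 - P (delta_mx ab.1 ab.2))).

Lemma transient_error_cvg0 : transient_error @ \oo --> (0 : R).
Proof.
rewrite /transient_error.
elim: (index_enum _) => [|ab r IH].
  by under eq_fun => t do rewrite big_nil; exact: cvg_cst.
under eq_fun => t do rewrite big_cons.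
have := cvgD (decay (delta_mx ab.1 ab.2)) IH.
by rewrite addr0; apply.
Qed.

Lemma transient_entry_le D (S : 'M[C]_d -> 'M[C]_D) t (X : 'M[C]_d) i j : cptp S ->
  (forall a b, `|X a b| <= 1) ->
  `|S (iter t T X) i j - S (iter t T (P X)) i j| <= (transient_error t)%:C%C.
Proof.
move=> cS X1; have ct := cptp_iter t cT.
have -> : S (iter t T X) i j - S (iter t T (P X)) i j = S (iter t T (X - P X)) i j.
  by rewrite (mxlinB ct.1.1) (mxlinB cS.1.1) !mxE.
apply: le_trans (cptp_entry_le _ _ _ cS) _.
pose N Y := iter t T (Y - P Y).
have lN : mxlinear N.
  move=> a Y Y'; rewrite /N cP.1.1 opprD addrACA -scalerBr ct.1.1 //.
rewrite -/(N X) (mxlinE lN) -rnormE lecR.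
apply: le_trans (_ : \sum_a \sum_b rnorm (N (delta_mx a b)) <= _); last first.
  by rewrite pair_bigA.
have tri (I : finType) (Y : I -> 'M[C]_d) : rnorm (\sum_i Y i) <= \sum_i rnorm (Y i).
  elim/big_rec2 : _ => [|k y y' _ H]; first by rewrite -(scale0r 0) rnormZ normr0 mul0r.
  by apply: le_trans (rnormD _ _) _; rewrite lerD2l.
apply: le_trans (tri _ _) _; apply: ler_sum => a _.
apply: le_trans (tri _ _) _; apply: ler_sum => b _.
rewrite rnormZ -[leRHS]mul1r ler_wpM2r ?rnorm_ge0 //.
by rewrite -lecR -normc_Re; apply: X1.
Qed.

End Error.

Section Codes.
Variables (d : nat) (N : linmap R d d).
Hypothesis cN : cptp N.

Lemma classical_codeP D (E : linmap R D d) (delta : R) : (0 < D)%N ->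
  classical_code N E delta <-> cptp E /\ exists S : linmap R d D, cptp S /\
    ((D%:R * (1 - delta))%:C%C <= \sum_i S (N (E (delta_mx i i))) i i).
Proof.
move=> D0; have DC : 0 < D%:R :> C by rewrite ltr0n.
have E1 (z : C) : ((1 - delta)%:C%C <= D%:R^-1 * z) = ((D%:R * (1 - delta))%:C%C <= z).
  by rewrite ler_pdivlMl // realCM realCn.
split=> [[/is_channelP cE [S [/is_channelP cS H]]]|[cE [S [cS H]]]].
  by split=> //; exists S; split=> //; rewrite -E1.
split; first exact/is_channelP.
by exists S; split; [apply/is_channelP | rewrite E1].
Qed.

Lemma quantum_codeP D (E : linmap R D d) (delta : R) : (0 < D)%N ->
  quantum_code N E delta <-> cptp E /\ exists S : linmap R d D, cptp S /\
    ((D%:R ^+ 2 * (1 - delta))%:C%C <= unnorm_fidelity (fun X => S (N (E X)))).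
Proof.
move=> D0; have DC : 0 < D%:R ^+ 2 :> C by rewrite exprn_gt0 // ltr0n.
have E1 (z : C) : ((1 - delta)%:C%C <= D%:R^-1 ^+ 2 * z) = ((D%:R ^+ 2 * (1 - delta))%:C%C <= z).
  by rewrite exprVn ler_pdivlMl // realCM realCX realCn.
have lin (S : linmap R d D) : cptp E -> cptp S -> mxlinear (fun X => S (N (E X))).
  by move=> cE cS; apply: (mxlin_comp cS.1.1 (mxlin_comp cN.1.1 cE.1.1)).
split=> [[/is_channelP cE [S [/is_channelP cS H]]]|[cE [S [cS H]]]].
  by split=> //; exists S; split=> //; rewrite -E1 -(maxent_fidelity (lin _ cE cS)).
split; first exact/is_channelP.
by exists S; split; [apply/is_channelP | rewrite (maxent_fidelity (lin _ cE cS)) E1].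
Qed.

Lemma Ccap_ge D E delta : (0 < D)%N -> @classical_code R d D N E delta ->
  ((log2 D%:R)%:E <= Ccap N delta)%E.
Proof. by move=> D0 HE; apply: ereal_sup_ubound; exists D => //; split=> //; exists E. Qed.

Lemma Qcap_ge D E delta : (0 < D)%N -> @quantum_code R d D N E delta ->
  ((log2 D%:R)%:E <= Qcap N delta)%E.
Proof. by move=> D0 HE; apply: ereal_sup_ubound; exists D => //; split=> //; exists E. Qed.

Lemma Ccap_le (delta y : R) :
  (forall D E, (0 < D)%N -> @classical_code R d D N E delta -> D%:R <= y) ->
  (Ccap N delta <= (log2 y)%:E)%E.
Proof.
move=> H; apply: ge_ereal_sup => _ [D [D0 [E HE]] <-].
by rewrite lee_fin ler_log2 ?ltr0n // (H D E).
Qed.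

Lemma Qcap_le (delta y : R) :
  (forall D E, (0 < D)%N -> @quantum_code R d D N E delta -> D%:R <= y) ->
  (Qcap N delta <= (log2 y)%:E)%E.
Proof.
move=> H; apply: ge_ereal_sup => _ [D [D0 [E HE]] <-].
by rewrite lee_fin ler_log2 ?ltr0n // (H D E).
Qed.

End Codes.

(** A decoder for t + 1 steps absorbs the last [T] and serves t steps. This gives existence of the
    limit, which the bounds on Q do not, as they differ. *)
Lemma Qcap_nonincreasing d (T : linmap R d d) delta : cptp T ->
  nonincreasing_seq (fun t => Qcap (chpow T t) delta).
Proof.
move=> cT; apply/nonincreasing_seqP => t.
apply: ge_ereal_sup => _ [D [D0 [E [cE [S [cS H]]]]] <-].
apply: ereal_sup_ubound; exists D => //; split=> //; exists E; split=> //.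
exists (S \o T); split; last exact: H.
by apply/is_channelP; apply: cptp_comp => //; apply/is_channelP.
Qed.

End Capacities.

Theorem theorem1 (R : realType) (d : nat) (T : linmap R d d)
  (K : nat) (dk mk : 'I_K -> nat)
  (V : forall k : 'I_K, 'M[R[i]]_(d, dk k * mk k))
  (omega : forall k : 'I_K, 'M[R[i]]_(mk k)) :
  (0 < d)%N ->
  is_channel T ->
  (forall k, (V k) ^t* *m V k = 1%:M) ->
  (forall k l, k != l -> (V k) ^t* *m V l = 0) ->
  (forall k, density (omega k)) ->
  peripheral T = [set X | exists Xs : forall k : 'I_K, 'M[R[i]]_(dk k),
                     X = \sum_(k < K) V k *m (Xs k *t omega k) *m (V k) ^t*] ->
  forall delta : R, 0 <= delta < 1 ->
    (fun t => Ccap (chpow T t) delta) @ \oo -->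
       (log2 (Num.floor ((\sum_(k < K) dk k)%:R / (1 - delta)))%:~R)%:E
    /\ exists q : \bar R,
         (fun t => Qcap (chpow T t) delta) @ \oo --> q
         /\ ((log2 (Num.floor ((\max_(k < K) dk k)%:R / Num.sqrt (1 - delta)))%:~R)%:E <= q)%E
         /\ (q <= (log2 ((\max_(k < K) dk k)%:R / (1 - delta)))%:E)%E.
Proof.
move=> d0 /is_channelP cT VI VO dens HP delta /andP[delta0 delta1].
set s := (\sum_(k < K) dk k)%N; set m := (\max_(k < K) dk k)%N.
have [A [cA rangeA decayA recA]] := asymptotic_projection cT.
have cP := cA 0%N; set P := A 0%N in cP rangeA decayA.
have rangeP X : exists Xs : forall k, 'M[R[i]]_(dk k), P X = \sum_k block_in V omega (Xs k).
  have := rangeA X; rewrite HP => -[Xs ->]; exists Xs.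
  by apply: eq_bigr => k _; rewrite block_inE.
have perG k (X : 'M[R[i]]_(dk k)) : peripheral T (block_in V omega X).
  rewrite HP; exists (@dfwith _ (fun k => 'M[R[i]]_(dk k)) (fun l => 0) k X).
  rewrite (bigD1 k) //= dfwithin block_inE big1 ?addr0 // => l lk.
  rewrite dfwithout 1?eq_sym // tens0mx.
  by rewrite mulmx0 mul0mx.
pose eps := transient_error T P.
have eps0 : eps @ \oo --> (0 : R) by apply: transient_error_cvg0.
(* The trace 1 of a matrix unit is distributed over the blocks, so they cannot all be empty. *)
have s_gt0 : (0 < s)%N.
  rewrite lt0n; apply/eqP => s0.
  have := sum_trace_block_out VI VO dens cP rangeP (delta_mx (Ordinal d0) (Ordinal d0)).
  rewrite mxtrace_delta eqxx big1 => [/esym/eqP|k _]; first by rewrite oner_eq0.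
  apply: big1 => -[i Hi]; exfalso.
  by move/eqP: s0; rewrite sum_nat_eq0 => /forallP/(_ k)/eqP dk0; rewrite dk0 in Hi.
have m_gt0 : (0 < m)%N.
  rewrite lt0n; apply: contraL s_gt0 => /eqP m0; rewrite -eqn0Ngt sum_nat_eq0.
  by apply/forallP => k /=; rewrite -leqn0 -m0 leq_bigmax.
have ct t : cptp (chpow T t) by apply: cptp_iter.
have c0 : 0 < 1 - delta by rewrite subr_gt0.
have entryE D (E : linmap R D d) (i j : 'I_D) a b : cptp E -> `|E (delta_mx i j) a b| <= 1.
  exact: cptp_entry_le1.
have real_le (x y : R) (z : R[i]) : (x%:C <= z)%C -> `|z| <= y%:C%C -> x <= y.
  rewrite lecE => /andP[_ xz] zy; apply: le_trans xz _; rewrite -lecR.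
  by apply: le_trans zy; apply: le_trans (normc_ge_Re z); rewrite lecR ler_norm.
have upC t D (E : linmap R D d) : (0 < D)%N -> classical_code (chpow T t) E delta ->
    D%:R * (1 - delta) <= s%:R + D%:R * eps t.
  move=> D0 /classical_codeP => /(_ D0)[cE [S [cS]]].
  set z := (X in _ <= X) => /real_le; apply.
  have -> : z = \sum_i (S (chpow T t (P (E (delta_mx i i)))) i i +
     (S (chpow T t (E (delta_mx i i))) i i - S (chpow T t (P (E (delta_mx i i)))) i i)).
    by apply: eq_bigr => i _; rewrite addrC subrK.
  rewrite big_split /= realCD realCM !realCn; apply: le_trans (ler_normD _ _) _.
  apply: lerD.
    exact: (classical_proj_le VI VO dens cP rangeP cE (cptp_comp cS (ct t))).
  apply: le_trans (ler_norm_sum _ _ _) _.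
  rewrite mulr_natl -[X in _ *+ X]card_ord -sumr_const; apply: ler_sum => i _.
  by apply: transient_entry_le => // a b; apply: entryE.
have upQ t D (E : linmap R D d) : (0 < D)%N -> quantum_code (chpow T t) E delta ->
    D%:R * (1 - delta) <= m%:R + D%:R * eps t.
  move=> D0 /(quantum_codeP (ct t)) => /(_ D0)[cE [S [cS]]].
  set z := (X in _ <= X) => /real_le H.
  have DR : 0 < D%:R :> R by rewrite ltr0n.
  (* Multiplied by D, the claim is the fidelity estimate; in the form divided by D, it has the
     classical shape and [eventually_size_le] applies to both. *)
  rewrite -(ler_pM2l DR) mulrA -expr2; apply: H.
  have -> : z = unnorm_fidelity ((S \o chpow T t) \o P \o E) + \sum_i \sum_j
     (S (chpow T t (E (delta_mx i j))) i j - S (chpow T t (P (E (delta_mx i j)))) i j).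
    rewrite /unnorm_fidelity -big_split; apply: eq_bigr => i _.
    by rewrite -big_split; apply: eq_bigr => j _; rewrite /= addrC subrK.
  rewrite mulrDr realCD !realCM !realCn; apply: le_trans (ler_normD _ _) _.
  apply: lerD.
    rewrite mulrC; exact: (quantum_proj_le VI VO dens cP rangeP cE (cptp_comp cS (ct t))).
  apply: le_trans (ler_norm_sum _ _ _) _.
  rewrite mulr_natl -[X in _ *+ X]card_ord -sumr_const; apply: ler_sum => i _.
  apply: le_trans (ler_norm_sum _ _ _) _.
  rewrite mulr_natl -[X in _ *+ X]card_ord -sumr_const; apply: ler_sum => j _.
  by apply: transient_entry_le => // a b; apply: entryE.
have ZG t k (X : 'M[R[i]]_(dk k)) : (A t \o chpow T t) (block_in V omega X) = block_in V omega X.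
  exact: recA.
have lowC t D : (0 < D)%N -> D%:R <= s%:R / (1 - delta) ->
    exists E : linmap R D d, classical_code (chpow T t) E delta.
  move=> D0 Ds; have [E [S [cE cS H]]] := classical_exact_code VI VO dens (ZG t) D0 s_gt0.
  exists E; apply/classical_codeP => //; split=> //; exists (S \o A t); split.
    exact: cptp_comp.
  apply: le_trans H; rewrite -realCn lecR; rewrite ler_pdivlMr // in Ds.
  (* For D <= s the code is perfect; otherwise the claim is [Ds]. *)
  by case: leqP => _ //; rewrite ler_piMr ?ler0n // gerBl.
have lowQ t D : (0 < D)%N -> D%:R <= m%:R / Num.sqrt (1 - delta) ->
    exists E : linmap R D d, quantum_code (chpow T t) E delta.
  move=> D0 Dm.
  have [k mE] : exists k, m = dk k.
    have K0 : (0 < #|'I_K|)%N.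
      rewrite card_ord lt0n; apply: contraL m_gt0 => /eqP K0.
      by rewrite -eqn0Ngt /m big1 // => -[i Hi]; exfalso; rewrite K0 in Hi.
    by have [k kE] := bigop.eq_bigmax dk K0; exists k.
  have dk0 : (0 < dk k)%N by rewrite -mE.
  have [E [S [cE cS H]]] := quantum_exact_code VI dens (ZG t) D0 dk0.
  exists E; apply/(quantum_codeP (ct t)) => //; split=> //; exists (S \o A t); split.
    exact: cptp_comp.
  apply: le_trans H; rewrite -realCn -realCX lecR -mE.
  have sq0 : 0 < Num.sqrt (1 - delta) by rewrite sqrtr_gt0.
  (* The guaranteed fidelity is the square of min(D, m) / D; this is the origin of the square root
     in the lower bound. *)
  rewrite -{1}(sqr_sqrtr (ltW c0)) -exprMn ler_pXn2r ?nnegrE ?mulr_ge0 ?ler0n ?(ltW sq0) //.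
  rewrite ler_pdivlMr // in Dm.
  case: leqP => _ //; rewrite ler_piMr ?ler0n //.
  by rewrite -[leRHS]sqrtr1 ler_wsqrtr // gerBl.
have ge1 (n : nat) (c : R) : (0 < n)%N -> 0 < c -> c <= 1 -> 1 <= n%:R / c :> R.
  move=> n0 c_gt0 c1; rewrite ler_pdivlMr // mul1r; apply: le_trans c1 _.
  by rewrite ler1n.
have c1 : 1 - delta <= 1 by rewrite gerBl.
split.
  have [n [n0 fE nx]] := floor_natE (ge1 _ _ s_gt0 c0 c1).
  (* The lower bound holds for all t and meets the upper bound from some t on, so the sequence is
     eventually constant. *)
  apply: cvg_near_cst.
  have := eventually_size_le (ler0n R s) c0 eps0; apply: filterS => t Ht.
  apply/eqP; rewrite eq_le; apply/andP; split.
    apply: Ccap_le => D E D0 HE; rewrite -[D%:R]/((Posz D)%:~R) ler_int floor_ge_int.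
    by apply: Ht; apply: upC HE.
  have [E HE] := lowC t n n0 nx.
  by rewrite fE; apply: Ccap_ge HE.
exists (ereal_inf ((fun t => Qcap (chpow T t) delta) @` setT)).
split; first exact/ereal_nonincreasing_cvgn/Qcap_nonincreasing.
have sq0 : 0 < Num.sqrt (1 - delta) by rewrite sqrtr_gt0.
have sq1 : Num.sqrt (1 - delta) <= 1 by rewrite -[leRHS]sqrtr1 ler_wsqrtr.
split.
  have [n [n0 fE nx]] := floor_natE (ge1 _ _ m_gt0 sq0 sq1).
  apply: le_ereal_inf_tmp => _ [t _ <-].
  have [E HE] := lowQ t n n0 nx.
  by rewrite fE; apply: Qcap_ge HE.
(* The limit is an infimum, so a single good t gives the upper bound. *)
have [t _ Ht] := eventually_size_le (ler0n R m) c0 eps0.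
apply: (@le_trans _ _ (Qcap (chpow T t) delta)).
  by apply: ereal_inf_lbound; exists t.
apply: Qcap_le => D E D0 HE.
by apply: (Ht t) => /=; [|apply: upQ HE].
Qed.
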